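(* Let $d\in\mathbb{N}$ and let $T$ be a $d$-parameter $C_0$-semigroup over a Hilbert space $\mathcal{H}$ with bounded generators. Then for some $\boldsymbol{\omega}\in\mathbb{R}_{\geq 0}^{d}$, the modified $d$-parameter $C_0$-semigroup $\tilde{T}=(e^{-\langle\mathbf{t},\boldsymbol{\omega}\rangle}T(\mathbf{t}))_{\mathbf{t}\in\mathbb{R}_{\geq 0}^{d}}$ has a regular unitary dilation.
   Context: Hilbert spaces are complex; $\mathfrak{L}(\mathcal{H})$ and $\mathfrak{L}(\mathcal{H},\mathcal{H}')$ denote bounded operators; $\mathbb{N}=\{1,2,\ldots\}$; $\langle\mathbf{t},\boldsymbol{\omega}\rangle=\sum_i t_i\omega_i$. A $d$-parameter $C_0$-semigroup over $\mathcal{H}$ is a map $T:\mathbb{R}_{\geq 0}^{d}\to\mathfrak{L}(\mathcal{H})$, continuous for the strong operator topology (SOT), with $T(\mathbf{0})=I$ and $T(\mathbf{s}+\mathbf{t})=T(\mathbf{s})T(\mathbf{t})$. Its generators $A_1,\ldots,A_d$ are the infinitesimal generators of its marginals, the commuting one-parameter $C_0$-semigroups $T_i(t)=T(t\mathbf{e}_i)$ ($\mathbf{e}_i$ the canonical unit vectors). For $\mathbf{t}=(t_i)_{i=1}^d\in\mathbb{R}^d$ put $\mathbf{t}^{+}=(\max\{t_i,0\})_i$ and $\mathbf{t}^{-}=(\max\{-t_i,0\})_i$. A regular unitary dilation of a $d$-parameter $C_0$-semigroup $T$ over $\mathcal{H}$ is a tuple $(U,\mathcal{H}',r)$, where $\mathcal{H}'$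 is a Hilbert space, $U$ is an SOT-continuous unitary representation of $(\mathbb{R}^d,+,\mathbf{0})$ over $\mathcal{H}'$, and $r\in\mathfrak{L}(\mathcal{H},\mathcal{H}')$ (necessarily isometric), such that $T(\mathbf{t}^{-})^{*}T(\mathbf{t}^{+})=r^{*}U(\mathbf{t})r$ for all $\mathbf{t}\in\mathbb{R}^d$. *)

(* Defs.v *)
From mathcomp Require Import all_boot all_order all_algebra sesquilinear complex.
From mathcomp Require Import all_classical all_reals all_analysis.

Set Implicit Arguments.
Unset Strict Implicit.
Unset Printing Implicit Defensive.

Import Order.TTheory GRing.Theory Num.Def Num.Theory.
Import numFieldNormedType.Exports.

Local Open Scope classical_set_scope.
Local Open Scope ring_scope.
Local Open Scope complex_scope.

(* The form [dot] is linear in its first argument and conjugate-linear in its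
   second one. *)
Record hilbertType (R : realType) := Hilbert {
  hilbert_car :> completeNormedModType R[i];
  dot : {dot hilbert_car for conjC};
  sqr_normE : forall x, `|x| ^+ 2 = dot x x }.

Record boundedOp (R : realType) (H K : hilbertType R) := BoundedOp {
  boundedOp_fun :> {linear H -> K};
  boundedOpP : exists M : R[i], forall x, `|boundedOp_fun x| <= M * `|x| }.

(* By the Riesz representation theorem there is exactly one such z for every y;
   the default value 0 is never used. *)
Definition adjoint (R : realType) (H K : hilbertType R) (A : boundedOp H K)
    (y : K) : H :=
  xget 0 [set z | forall x, dot K (A x) y = dot H x z].

Definition unitary (R : realType) (H : hilbertType R) (U : boundedOp H H) :=
  forall x, adjoint U (U x) = x /\ U (adjoint U x) = x.

Section Orthant.
Context (R : realType) (d : nat).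
Implicit Types s t w : 'rV[R]_d.

Definition orthant : set 'rV[R]_d := [set t | forall i, 0 <= t 0 i].

Definition pos_part t : 'rV[R]_d := \row_i Num.max (t 0 i) 0.

Definition neg_part t : 'rV[R]_d := \row_i Num.max (- t 0 i) 0.

Definition pairing t w : R := \sum_i t 0 i * w 0 i.

End Orthant.
Arguments orthant {R d}.

(* The parameter ranges over [orthant] only: the values of [sg_fun] outside of
   it are unconstrained and irrelevant. *)
Record C0_semigroup (R : realType) (d : nat) (H : hilbertType R) :=
  C0Semigroup {
    sg_fun :> 'rV[R]_d -> boundedOp H H;
    sg0 : forall x, sg_fun 0 x = x;
    sgD : forall s t, orthant s -> orthant t ->
      forall x, sg_fun (s + t) x = sg_fun s (sg_fun t x);
    sg_cts : forall x, {within orthant, continuous (fun t => sg_fun t x)} }.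

Section Generators.
Context (R : realType) (H : hilbertType R).

Definition marginal (d : nat) (T : C0_semigroup d H) (i : 'I_d) (t : R) :
  boundedOp H H := T (t *: delta_mx 0 i).

Definition diff_quotient (S : R -> boundedOp H H) (x : H) (t : R) : H :=
  (t^-1)%:C *: (S t x - x).

Definition generator_dom (S : R -> boundedOp H H) : set H :=
  [set x | cvg (diff_quotient S x t @[t --> 0^'+])].

Definition generator (S : R -> boundedOp H H) (x : H) : H :=
  lim (diff_quotient S x t @[t --> 0^'+]).

(* The generator is an element of the algebra of bounded operators on H, hence
   everywhere defined. *)
Definition bounded_generator (S : R -> boundedOp H H) :=
  generator_dom S = setT /\
  exists M : R[i], forall x, `|generator S x| <= M * `|x|.

End Generators.

Section Damping.
Context (R : realType) (d : nat) (H : hilbertType R).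
Variables (T : C0_semigroup d H) (w : 'rV[R]_d).

Local Notation K := (Num.NumField.sort (R[i] : numFieldType)).

Definition damping (t : 'rV[R]_d) : R[i] := (expR (- pairing t w))%:C.

Lemma damping_cts : continuous (damping : 'rV[R]_d -> K).
Proof.
have realC_cts : continuous (fun r : R => r%:C : K).
  move=> r; apply/cvgrPdist_lt => /= e e0.
  have e_re : e = (complex.Re e)%:C by rewrite RRe_real // gtr0_real.
  have re0 : 0 < complex.Re e by rewrite -ltcR -e_re.
  near=> s; rewrite -rmorphB normc_def /= expr0n addr0 sqrtr_sqr e_re ltcR.
  by near: s; apply: cvgr_dist_lt.
have pairing_cts : continuous (fun t : 'rV[R]_d => pairing t w).
  apply: continuous_big => [|i _ t]; first exact: add_continuous.
  apply: (@cvgMr_tmp _ _ (nbhs t)); exact: coord_continuous.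
move=> t; apply: (@continuous_comp _ _ _ (fun t => expR (- pairing t w))
  (fun r : R => r%:C : K)); last exact: realC_cts.
apply: (@continuous_comp _ _ _ (fun t => - pairing t w) expR).
  by apply: (@cvgN _ _ _ (nbhs t)); exact: pairing_cts.
exact: continuous_expR.
Unshelve. all: by end_near. Qed.

Lemma damped_bounded t :
  exists M : R[i], forall x, `|(damping t \*: T t) x| <= M * `|x|.
Proof.
have [M leM] := boundedOpP (T t).
by exists (`|damping t| * M) => x /=; rewrite normrZ -mulrA ler_wpM2l.
Qed.

Definition damped_fun (t : 'rV[R]_d) : boundedOp H H :=
  BoundedOp (damped_bounded t).

Lemma damped0 x : damped_fun 0 x = x.
Proof.
rewrite /= /damping /pairing big1 => [|i _]; last by rewrite mxE mul0r.
by rewrite oppr0 expR0 sg0 scale1r.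
Qed.

Lemma dampedD s t : orthant s -> orthant t ->
  forall x, damped_fun (s + t) x = damped_fun s (damped_fun t x).
Proof.
move=> s0 t0 x /=; rewrite sgD // linearZ scalerA; congr (_ *: _).
rewrite /damping -rmorphM -expRD -opprD; congr ((expR (- _))%:C).
by rewrite /pairing -big_split; apply: eq_bigr => i _; rewrite mxE mulrDl.
Qed.

Lemma damped_cts x : {within orthant, continuous (fun t => damped_fun t x)}.
Proof.
move=> t; apply: (@cvgZ _ _ _ (nbhs (t : subspace orthant))); last exact: sg_cts.
by apply: (continuous_subspaceT damping_cts).
Qed.

Definition damped : C0_semigroup d H := C0Semigroup damped0 dampedD damped_cts.

End Damping.

Record unitary_rep (R : realType) (d : nat) (H : hilbertType R) := UnitaryRep {
  ur_fun :> 'rV[R]_d -> boundedOp H H;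
  ur_unitary : forall t, unitary (ur_fun t);
  ur0 : forall x, ur_fun 0 x = x;
  urD : forall s t x, ur_fun (s + t) x = ur_fun s (ur_fun t x);
  ur_cts : forall x, continuous (fun t => ur_fun t x) }.

Definition regular_unitary_dilation (R : realType) (d : nat)
    (H H' : hilbertType R) (T : C0_semigroup d H) (U : unitary_rep d H')
    (r : boundedOp H H') :=
  forall t x, adjoint (T (neg_part t)) (T (pos_part t) x) = adjoint r (U t (r x)).

Definition has_regular_unitary_dilation (R : realType) (d : nat)
    (H : hilbertType R) (T : C0_semigroup d H) :=
  exists (H' : hilbertType R) (U : unitary_rep d H') (r : boundedOp H H'),
    regular_unitary_dilation T U r.

(* Main.v *)
From HB Require Import structures.
Require Import Defs.
From mathcomp Require Import all_boot all_order all_algebra sesquilinear complex.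
From mathcomp Require Import ring lra zify.
From mathcomp Require Import all_classical all_reals all_analysis.

(** Why the theorem is true.  A regular unitary dilation of [T] exists as soon
as the operator-valued function [t |-> T (t^-)^* T (t^+)] on [R^d] is positive
definite, and strong enough damping makes it positive definite.

Dilation.  A positive definite function turns the finitely supported functions
[R^d -> H] into a semi-inner product space on which translations act
isometrically.  Its completion carries the unitary representation
([unitary_extension]), and [r x] is the class of the function with value [x] at
[0] and [0] elsewhere; this is Naimark's theorem ([naimark]).  The completion of
a semi-inner product space is built as the closure of the space in its
antidual.

Positivity.  On a grid of mesh [h] the semigroup is a product of powers of the
commuting operators [S_i = T (h e_i)].  Brehmer's criterion
([brehmer_kernel_ge0]) says that it suffices to see that the inner product stays
nonnegative after replacing, for any set of coordinates [i], the form [B (x, y)]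
by its defect [B (x, y) - B (S_i x, S_i y)]: a telescoping sum writes the kernel
as a sum of kernels for fewer coordinates.  Dyadic grids and continuity then
give the positivity on [R^d] ([regular_kernel_ge0]).

Damping.  Now [S_i = q T_i] with [q = e^(- h w)] and [T_i] within [M h] of the
identity.  Up to the positive factor [1 - q^2], a defect changes a form that is
close to the inner product only by a relative amount of order
[h q^2 / (1 - q^2) <= 1 / (2 w)], whatever the mesh.  If [w] is large compared
with [d M (2 + M)], the at most [d] successive defects leave the form within
relative distance [1] of a positive multiple of the inner product, hence nonnegative
([brehmer_dot], [damping_estimate]).

The constant [M] is where the generators enter: the difference quotients of the
marginals along [h = 2 ^- k] converge pointwise because the generators are
everywhere defined, so they are uniformly bounded in norm
([uniform_boundedness], [bounded_generator_dyadic]). *)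

Set Implicit Arguments.
Unset Strict Implicit.
Unset Printing Implicit Defensive.

Import Order.TTheory GRing.Theory Num.Def Num.Theory.
Import numFieldNormedType.Exports.

Local Open Scope classical_set_scope.
Local Open Scope ring_scope.

(** * Semi-inner product spaces *)

Record semidot (C : numClosedFieldType) (V : lmodType C) := Semidot {
  semidot_form :> {hermitian_sym V for conjC};
  semidot_ge0 : forall v, 0 <= semidot_form v v }.

Section Semidot.
Context (C : numClosedFieldType) (V : lmodType C) (B : semidot V).
Implicit Types (u v w : V) (a : C).

Lemma semidotC u v : B u v = (B v u)^*.
Proof. by rewrite hermC expr0 mul1r. Qed.

Lemma semidotDl u v w : B (u + v) w = B u w + B v w.
Proof. exact: linearDl. Qed.

Lemma semidotBl u v w : B (u - v) w = B u w - B v w.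
Proof. exact: linearBl. Qed.

Lemma semidotDr u v w : B w (u + v) = B w u + B w v.
Proof. exact: linearDr. Qed.

Lemma semidotBr u v w : B w (u - v) = B w u - B w v.
Proof. exact: linearBr. Qed.

Lemma semidotZl a u v : B (a *: u) v = a * B u v.
Proof. exact: linearZl_LR. Qed.

Lemma semidotZr a u v : B u (a *: v) = a^* * B u v.
Proof. exact: linearZr_LR. Qed.

(** The usual minimization over the line [u - a v] breaks down when [v] is a
null vector; then [B u v] must vanish, since otherwise the affine function
[a |-> B (u - a v) (u - a v)] would take the value [-1]. *)
Lemma semidot_CauchySchwarz u v : `|B u v| ^+ 2 <= B u u * B v v.
Proof.
have key a : 0 <= B u u - a^* * B u v - a * (B u v)^* + a * a^* * B v v.
  have := semidot_ge0 B (u - a *: v); congr (_ <= _).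
  rewrite linearBl /= !linearBr /= !semidotZl !semidotZr (semidotC v u).
  by move: (B u u) (B u v) (B v v) (B u v)^* => b c d e; ring.
rewrite normCK.
have [v0|vN0] := eqVneq (B v v) 0; last first.
  have v_gt0 : 0 < B v v by rewrite lt_def vN0 semidot_ge0.
  have := key (B u v / B v v); rewrite rmorphM fmorphV /= -(semidotC v v).
  set b := B u u; set c := B u v; set d := B v v; set e := c^*.
  rewrite (_ : _ + _ = b - c * e / d); last by rewrite /d; field.
  by rewrite subr_ge0 ler_pdivrMr.
rewrite v0 mulr0.
have [-> |uvN0] := eqVneq (B u v) 0; first by rewrite mul0r.
(* For this value of [a] the quadratic expression equals [-1]. *)
have := key ((B u u + 1) / (2 * (B u v)^*)).
rewrite v0 mulr0 addr0 rmorphM fmorphV rmorphM /= conjCK.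
rewrite rmorphD rmorph1 /= -(semidotC u u) (rmorph_nat _ 2).
have cN0 : (B u v)^* != 0 by rewrite conjC_eq0.
move: (B u u) (B u v) (B u v)^* uvN0 cN0 => b c d cN0 dN0.
rewrite (_ : _ - _ - _ = - 1); first by rewrite oppr_ge0 ler10.
by field; rewrite cN0 dN0.
Qed.

Definition seminorm v := sqrtC (B v v).

Lemma seminorm_ge0 v : 0 <= seminorm v.
Proof. by rewrite sqrtC_ge0 semidot_ge0. Qed.

Lemma seminormK v : seminorm v ^+ 2 = B v v.
Proof. by rewrite sqrtCK. Qed.

Lemma seminormZ a v : seminorm (a *: v) = `|a| * seminorm v.
Proof.
apply/eqP; rewrite -(@eqrXn2 _ 2) ?mulr_ge0 ?seminorm_ge0 //.
by rewrite exprMn !seminormK semidotZl semidotZr mulrA normCK.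
Qed.

Lemma seminorm_dot u v : `|B u v| <= seminorm u * seminorm v.
Proof.
rewrite -(@ler_pXn2r _ 2) ?nnegrE ?mulr_ge0 ?seminorm_ge0 //.
by rewrite exprMn !seminormK semidot_CauchySchwarz.
Qed.

Lemma seminormD u v : seminorm (u + v) <= seminorm u + seminorm v.
Proof.
rewrite -(@ler_pXn2r _ 2) ?nnegrE ?addr_ge0 ?seminorm_ge0 //.
rewrite seminormK linearDl /= !linearDr /= sqrrD !seminormK.
rewrite [X in X <= _]addrA lerD2r -addrA lerD2l mulr2n (semidotC v u).
have uv := seminorm_dot u v.
apply: le_trans (lerD uv uv).
rewrite -[X in _ <= _ + X]norm_conjC; apply: le_trans (ler_normD _ _).
apply: real_ler_norm; by apply/CrealP; rewrite rmorphD /= conjCK addrC.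
Qed.

(** Testing [v] against itself turns a bound on the functional into a bound
on the vector. *)
Lemma seminorm_le v a : 0 <= a ->
  (forall w, `|B v w| <= a * seminorm w) -> seminorm v <= a.
Proof.
move=> a0 /(_ v); rewrite ger0_norm ?semidot_ge0 // -seminormK expr2.
have [->|vN0] := eqVneq (seminorm v) 0; first by [].
by rewrite ler_pM2r // lt_def vN0 seminorm_ge0.
Qed.

End Semidot.

(** * Limits of complex numbers *)

Section ComplexLimits.
Context (C : numClosedFieldType).

(** In a field with a partial order the half-line [0, +oo) is the equalizer of
the norm and the identity, hence closed. *)
Lemma cvg_ge0 T (F : set_system T) (FF : ProperFilter F) (f : T -> C) (l : C) :
  f @ F --> l -> (\forall x \near F, 0 <= f x) -> 0 <= l.
Proof.
move=> fl f0; suff -> : l = `|l| by [].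
have fl' : (fun x => `|f x|) @ F --> l.
  apply: cvg_trans fl; apply: near_eq_cvg; near=> x.
  by rewrite ger0_norm //; near: x.
have fl2 : (fun x => `|f x|) @ F --> `|l| by apply: cvg_norm fl.
apply: norm_cvg_unique fl' fl2.
Unshelve. all: by end_near. Qed.

Lemma cvg_le T (F : set_system T) (FF : ProperFilter F) (f g : T -> C)
    (a b : C) : f @ F --> a -> g @ F --> b ->
  (\forall x \near F, f x <= g x) -> a <= b.
Proof.
move=> fa gb fg; rewrite -subr_ge0.
apply: (@cvg_ge0 _ F FF (fun x => g x - f x)); first exact: cvgB.
by near=> x; rewrite subr_ge0; near: x.
Unshelve. all: by end_near. Qed.

Lemma cvg_conjC T (F : set_system T) (FF : ProperFilter F) (f : T -> C)
    (l : C) : f @ F --> l -> (fun x => (f x)^*) @ F --> l^*.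
Proof.
move=> /cvgrPdist_lt fl; apply/cvgrPdist_lt => e e0.
by near do rewrite -rmorphB norm_conjC; apply: fl.
Unshelve. all: by end_near. Qed.

Lemma cvg_scale T (F : set_system T) (FF : ProperFilter F) (f : T -> C)
    (a l : C) : f @ F --> l -> (fun x => a * f x) @ F --> a * l.
Proof. by move=> fl; apply: cvgM fl; exact: cvg_cst. Qed.

End ComplexLimits.

(** Convergence in [R[i]] can be tested on real and imaginary parts. *)
Lemma complex_complete (R : realType)
    (F : set_system (R[i] : numClosedFieldType)) (FF : ProperFilter F) :
  cauchy F -> cvg F.
Proof.
move=> /cauchy_ballP Fc.
have part (p : R[i] -> R) : (forall x y, `|p x - p y|%:C%C <= `|x - y|) ->
    exists l : R, p @ F --> l.
  move=> p1; apply/cvg_ex; apply: cauchy_cvg; apply/cauchy_ballP => e e0.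
  have eC0 : 0 < e%:C%C :> R[i] by rewrite ltcR.
  have [[A B] [/= FA FB] AB] := Fc _ eC0.
  exists (p @` A, p @` B) => /=.
    by split; [apply: filterS FA|apply: filterS FB] => x Ax; exists x.
  case=> _ _ [/= [x Ax <-] [y By <-]]; rewrite /ball /=.
  have /= := AB (x, y) (conj Ax By); rewrite /ball /= => xy.
  by rewrite -ltcR (le_lt_trans _ xy) // p1.
have [a Fa] : exists l : R, (@complex.Re R) @ F --> l.
  by apply: part => x y; rewrite -raddfB normc_ge_Re.
have [b Fb] : exists l : R, (@complex.Im R) @ F --> l.
  apply: part => x y; rewrite -raddfB /=; case: (x - y) => c d /=.
  rewrite normc_def /= lecR -sqrtr_sqr ler_sqrt ?lerDr ?sqr_ge0 //.
  by rewrite addr_ge0 ?sqr_ge0.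
apply/cvg_ex; exists (a +i* b)%C.
apply/cvgrPdist_lt => /= e e0.
have e_re : e = (complex.Re e)%:C%C by rewrite RRe_real // gtr0_real.
have re0 : 0 < complex.Re e by rewrite -ltcR -e_re.
near=> z.
have za : `|a - complex.Re z| < complex.Re e / 2.
  by near: z; move/cvgrPdist_lt: Fa; apply; rewrite divr_gt0.
have zb : `|b - complex.Im z| < complex.Re e / 2.
  by near: z; move/cvgrPdist_lt: Fb; apply; rewrite divr_gt0.
rewrite (_ : _ - _ = (a - complex.Re z)%:C%C + 'i%C * (b - complex.Im z)%:C%C);
  last by clear; case: z => c d; simpc.
rewrite (le_lt_trans (ler_normD _ _)) // normrM e_re.
rewrite !normc_def /= !expr0n /= expr1n add0r sqrtr1 mul1r !addr0 !sqrtr_sqr.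
by rewrite -rmorphD ltcR; lra.
Unshelve. all: by end_near. Qed.

Lemma invS_gt0 (R : realType) n : 0 < n.+1%:R^-1 :> R[i].
Proof. by rewrite invr_gt0 ltr0Sn. Qed.

Lemma invn_near (R : realType) (e : R[i]) : 0 < e ->
  \forall n \near \oo, n.+1%:R^-1 <= e.
Proof.
move=> e0; have e_re : e = (complex.Re e)%:C%C by rewrite RRe_real // gtr0_real.
have re0 : 0 < complex.Re e by rewrite -ltcR -e_re.
near=> n; rewrite e_re -(rmorph_nat (real_complex R)) -fmorphV lecR ltW //.
by near: n; exact: near_infty_natSinv_lt (PosNum re0).
Unshelve. all: by end_near. Qed.

(** * Completion of a semi-inner product space *)

Section Completion.
Context (R : realType) (V : lmodType R[i]) (B : semidot V).
Local Notation C := (R[i] : numClosedFieldType).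
Implicit Types (u v w p : V) (e : R[i]).
Local Notation pn := (seminorm B).

(** [f] is at distance at most [e], in the dual seminorm, from the antilinear
functional defined by [v]. *)
Definition approximates (f : V -> C) v e :=
  forall p, `|f p - B v p| <= e * pn p.

(** The completion is the closure of the image of [V] in its antidual: a point
of the completion is a function on [V] rather than a class of Cauchy sequences,
and it inherits additivity and boundedness from the functionals that approximate
it ([completion_additive], [completion_bounded]). *)
Definition completion_pred : {pred V -> (R[i])^o} :=
  fun f => `[< forall e, 0 < e -> exists v, approximates f v e >].

Lemma completion_submod : submod_closed completion_pred.
Proof.
split=> [|a f g /asboolP fP /asboolP gP]; apply/asboolP => e e0.
  by exists 0 => p; rewrite linear0l subr0 normr0 mulr_ge0 ?seminorm_ge0 ?ltW.
have e2 : 0 < e / 2 by rewrite divr_gt0.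
have [w gw] := gP _ e2.
have a1 : 0 < `|a| + 1 by rewrite ltr_wpDl.
have [v fv] := fP _ (divr_gt0 e2 a1).
exists (a *: v + w) => p.
rewrite semidotDl semidotZl -[(a *: f + g) p]/(a * f p + g p) opprD addrACA.
rewrite -mulrBr (le_trans (ler_normD _ _)) // normrM [e]splitr mulrDl lerD //.
rewrite (le_trans (ler_wpM2l (normr_ge0 a) (fv p))) // mulrA ler_wpM2r //.
  exact: seminorm_ge0.
by rewrite mulrA ler_pdivrMr // mulrC ler_pM2l // lerDl.
Qed.

HB.instance Definition _ :=
  GRing.isSubmodClosed.Build _ _ completion_pred completion_submod.

Record completion := Completion {
  completion_fun :> V -> (R[i])^o;
  completionP : completion_fun \in completion_pred }.

HB.instance Definition _ := [isSub for completion_fun].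
HB.instance Definition _ := [Choice of completion by <:].
HB.instance Definition _ := [SubChoice_isSubLmodule of completion by <:].

Implicit Types (f g h : completion).

Lemma completionB f g p : (f - g) p = f p - g p.
Proof. by []. Qed.

Lemma completionPZ a f g p : (a *: f + g) p = a * f p + g p.
Proof. by []. Qed.

Lemma completion_inj f g : f =1 g -> f = g.
Proof. by move=> fg; apply/val_inj/funext => p; exact: fg. Qed.

Lemma completion_approx f e : 0 < e -> exists v, approximates f v e.
Proof. by have /asboolP fP := completionP f; exact: fP. Qed.

Lemma canonical_subproof v : (fun p => B v p : (R[i])^o) \in completion_pred.
Proof.
apply/asboolP => e e0; exists v => p.
by rewrite subrr normr0 mulr_ge0 ?seminorm_ge0 ?ltW.
Qed.

Definition canonical v := Completion (canonical_subproof v).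

(** The defect of additivity of [f] is arbitrarily small because [f] is close
to additive functionals. *)
Lemma completion_additive f p q : f (p - q) = f p - f q.
Proof.
apply/eqP; rewrite -subr_eq0 -normr_le0; apply/ler_addgt0Pl => /= d d0.
set S := pn (p - q) + (pn p + pn q) + 1.
have S0 : 0 < S by rewrite ltr_wpDl ?addr_ge0 ?seminorm_ge0.
have [v fv] := completion_approx f (divr_gt0 d0 S0).
rewrite addr0 (_ : _ - _ = (f (p - q) - B v (p - q))
   - ((f p - B v p) - (f q - B v q))); last first.
  by rewrite semidotBr; move: (f _) (f _) (f _) => a b c; ring.
rewrite (le_trans (ler_normB _ _)) //.
rewrite (le_trans (lerD (fv _) (ler_normB _ _))) //.
rewrite (le_trans (lerD (lexx _) (lerD (fv _) (fv _)))) // -!mulrDr.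
by rewrite mulrAC ler_pdivrMr // ler_pM2l // lerDl.
Qed.

Lemma completion_bounded f : exists2 M, 0 < M & forall p, `|f p| <= M * pn p.
Proof.
have [v fv] := completion_approx f ltr01.
exists (1 + pn v) => [|p]; first by rewrite ltr_pwDl ?seminorm_ge0.
rewrite -[f p](subrK (B v p)) (le_trans (ler_normD _ _)) // mulrDl.
by rewrite lerD // seminorm_dot.
Qed.

Lemma approximates_dist f v w d e : approximates f v d -> approximates f w e ->
  0 <= d -> 0 <= e -> pn (v - w) <= d + e.
Proof.
move=> fv fw d0 e0; apply: seminorm_le => [|p]; first exact: addr_ge0.
rewrite semidotBl (_ : _ - _ = (f p - B w p) - (f p - B v p)); last first.
  by move: (f p) (B w p) (B v p) => a b c; ring.
by rewrite (le_trans (ler_normB _ _)) // addrC mulrDl lerD.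
Qed.

(** Convergence of a sequence of [V] to a point of the completion, in the dual
seminorm. *)
Definition tends (w : nat -> V) g :=
  forall e, 0 < e -> \forall n \near \oo, approximates g (w n) e.

Definition approx_seq g n : V :=
  sval (cid (completion_approx g (invS_gt0 R n))).

Lemma approx_seq_tends g : tends (approx_seq g) g.
Proof.
move=> e e0; near=> n => p.
apply: le_trans (_ : n.+1%:R^-1 * pn p <= _).
  by rewrite /approx_seq; case: cid => v /= fv; exact: fv.
rewrite ler_wpM2r ?seminorm_ge0 //; near: n; exact: invn_near.
Unshelve. all: by end_near. Qed.

Lemma canonical_tends v : tends (fun=> v) (canonical v).
Proof.
by move=> e e0; near=> n => p; rewrite subrr normr0 mulr_ge0 ?seminorm_ge0 ?ltW.
Unshelve. all: by end_near. Qed.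

Lemma tends_dist g (v w : nat -> V) e : tends v g -> tends w g -> 0 < e ->
  \forall n & m \near \oo, pn (v n - w m) <= e.
Proof.
move=> vg wg e0; have e2 : 0 < e / 2 by rewrite divr_gt0.
exists ([set n | approximates g (v n) (e / 2)],
        [set n | approximates g (w n) (e / 2)]) => /=.
  by split; [exact: vg|exact: wg].
move=> [n m] /= [vn wm]; rewrite [e]splitr.
by apply: (approximates_dist vn wm); exact: ltW.
Qed.

Definition completion_dot f g : C :=
  lim (f (approx_seq g n) @[n --> \oo] : set_system C).

(** The scalar product of [f] and [g] is the limit of [f] along any sequence of
[V] representing [g]: such sequences are Cauchy and [f] is bounded, hence
uniformly continuous. *)
Lemma completion_dot_cvg f g (w : nat -> V) : tends w g ->
  (f (w n) : C) @[n --> \oo] --> completion_dot f g.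
Proof.
have dist (u v : nat -> V) : tends u g -> tends v g -> forall e, 0 < e ->
    \forall n & m \near \oo, `|f (u n) - f (v m)| < e.
  have [M M0 fM] := completion_bounded f.
  move=> ug vg e e0; have e2 : 0 < e / 2 / M by rewrite !divr_gt0.
  have uv := tends_dist ug vg e2; apply: filterS uv => -[n m] /= nm.
  rewrite -completion_additive (le_lt_trans (fM _)) //.
  rewrite (le_lt_trans (ler_wpM2l (ltW M0) nm)) // mulrCA mulfV ?gt_eqF //.
  by rewrite mulr1 gtr_pMr // invf_lt1 // ltr1n.
have gg := approx_seq_tends g.
have fc : (f (approx_seq g n) : C) @[n --> \oo] --> completion_dot f g.
  apply: complex_complete; apply/cauchy_ballP => e e0; rewrite near_map2.
  exact: (dist _ _ gg gg).
move=> wg; apply/cvgrPdist_lt => e e0.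
move/cvgrPdist_lt: fc => /(_ _ (divr_gt0 e0 (@ltr0Sn _ 1))) fc.
have [[P Q] /= [oP oQ] PQ] := dist _ _ gg wg _ (divr_gt0 e0 (@ltr0Sn _ 1)).
near \oo => m; near=> n.
rewrite [e]splitr -(subrKA (f (approx_seq g m))).
rewrite (le_lt_trans (ler_normD _ _)) //.
rewrite ltrD //; first by near: m.
apply: (PQ (m, n)); split => /=; first by near: m.
by near: n.
Unshelve. all: by end_near. Qed.

Lemma completion_dot_unique f g (w : nat -> V) (l : C) : tends w g ->
  (f (w n) : C) @[n --> \oo] --> l -> completion_dot f g = l.
Proof. by move=> wg; apply: norm_cvg_unique; exact: completion_dot_cvg. Qed.

Lemma completion_dot_linear a f g h :
  completion_dot (a *: f + g) h = a * completion_dot f h + completion_dot g h.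
Proof.
have hh := approx_seq_tends h.
apply: (completion_dot_unique hh).
apply: cvgD; last exact: completion_dot_cvg.
by apply: cvg_scale; exact: completion_dot_cvg.
Qed.

Lemma tends_bounded g (w : nat -> V) : tends w g ->
  exists2 M, 0 < M & \forall n \near \oo, pn (w n) <= M.
Proof.
move=> wg; have [[P Q] /= [oP oQ] PQ] := tends_dist wg wg ltr01.
near \oo => m; exists (1 + pn (w m)); first by rewrite ltr_pwDl ?seminorm_ge0.
near=> n; rewrite -[w n](subrK (w m)) (le_trans (seminormD _ _ _)) //.
rewrite lerD2r; apply: (PQ (n, m)); split => /=; first by near: n.
by near: m.
Unshelve. all: by end_near. Qed.

Lemma completion_dot_cvg2 f g (v w : nat -> V) : tends v f -> tends w g ->
  (B (v n) (w n) : C) @[n --> \oo] --> completion_dot f g.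
Proof.
move=> vf wg; have [M M0 wM] := tends_bounded wg.
have fc := @completion_dot_cvg f _ _ wg.
apply/cvgrPdist_lt => e e0; have e2 : 0 < e / 2 by rewrite divr_gt0.
move/cvgrPdist_lt: fc => /(_ _ e2) fc.
near=> n.
rewrite [e]splitr -(subrKA (f (w n))) (le_lt_trans (ler_normD _ _)) //.
rewrite ltr_leD //; first by near: n.
have vn : approximates f (v n) (e / 2 / M).
  by near: n; apply: vf; rewrite divr_gt0.
rewrite (le_trans (vn _)) // mulrAC ler_pdivrMr // ler_pM2l //.
by near: n.
Unshelve. all: by end_near. Qed.

Lemma completion_dotC f g : completion_dot f g = (completion_dot g f)^*.
Proof.
have ff := approx_seq_tends f; have gg := approx_seq_tends g.
apply: norm_cvg_unique (completion_dot_cvg2 ff gg) _.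
have -> : (fun n => B (approx_seq f n) (approx_seq g n)) =
    (fun n => (B (approx_seq g n) (approx_seq f n))^*).
  by apply/funext => n; rewrite -semidotC.
exact: cvg_conjC (completion_dot_cvg2 gg ff).
Qed.

Lemma completion_dot_ge0 f : 0 <= completion_dot f f.
Proof.
have ff := approx_seq_tends f.
apply: cvg_ge0 (completion_dot_cvg2 ff ff) _.
by near=> n; exact: semidot_ge0.
Unshelve. all: by end_near. Qed.

(** The reproducing property: evaluation at [v] is the scalar product with the
image of [v].  It yields definiteness through the Cauchy-Schwarz inequality. *)
Lemma completion_reproducing f v : completion_dot f (canonical v) = f v.
Proof.
by apply: completion_dot_unique (canonical_tends v) _; exact: cvg_cst.
Qed.

Lemma completion_dot_bilinear : bilinear_for
  (GRing.Scale.Law.clone _ _ *%R _) (GRing.Scale.Law.clone _ _ (conjC \; *%R) _)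
  completion_dot.
Proof.
split=> [h a f g|h a f g]; first exact: completion_dot_linear.
rewrite !(completion_dotC h) completion_dot_linear rmorphD rmorphM /=.
by [].
Qed.

HB.instance Definition _ := bilinear_isBilinear.Build R[i] completion completion
  R[i] *%R (conjC \; *%R) completion_dot completion_dot_bilinear.

Lemma completion_dot_hermitian f g :
  completion_dot f g = (-1) ^+ false * (completion_dot g f)^*.
Proof. by rewrite expr0 mul1r -completion_dotC. Qed.

HB.instance Definition _ := isHermitianSesquilinear.Build R[i] completion
  false conjC completion_dot completion_dot_hermitian.

Definition completion_semidot : semidot completion :=
  @Semidot _ _ completion_dot completion_dot_ge0.
Local Notation cn := (seminorm completion_semidot).

Lemma completion_eval_bound f p : `|f p| <= cn f * pn p.
Proof.
have := seminorm_dot completion_semidot f (canonical p).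
by rewrite /seminorm /= !completion_reproducing.
Qed.

Lemma completion_norm_eq0 f : cn f = 0 -> f = 0.
Proof.
move=> f0; apply: completion_inj => p; apply/eqP; rewrite -normr_le0.
by rewrite (le_trans (completion_eval_bound _ _)) // f0 mul0r.
Qed.

Lemma completion_dot_gt0 f : f != 0 -> 0 < completion_dot f f.
Proof.
move=> fN0; rewrite lt_def completion_dot_ge0 andbT; apply: contra_neq fN0.
by move=> f0; apply: completion_norm_eq0; rewrite /seminorm /= f0 sqrtC0.
Qed.

HB.instance Definition _ := isDotProduct.Build R[i] completion
  completion_dot completion_dot_gt0.

HB.instance Definition _ := Lmodule_isNormed.Build R[i] completion
  (seminormD completion_semidot) (seminormZ completion_semidot)
  completion_norm_eq0.

Lemma completion_normE f : `|f| = cn f. Proof. by []. Qed.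

(** The converse of [completion_eval_bound]: the norm is the dual norm. *)
Lemma completion_norm_le f a : 0 <= a ->
  (forall p, `|f p| <= a * pn p) -> `|f| <= a.
Proof.
move=> a0 fa; have ff := approx_seq_tends f.
have f1 := @completion_dot_cvg f _ _ ff; have f2 := completion_dot_cvg2 ff ff.
have D2 : `|completion_dot f f| ^+ 2 <= a ^+ 2 * completion_dot f f.
  have f3 : (fun n => `|f (approx_seq f n)| * `|f (approx_seq f n)| : C) @ \oo
      --> (`|completion_dot f f| * `|completion_dot f f| : C).
    by apply: cvgM; exact: cvg_norm f1.
  have f4 : (fun n => a ^+ 2 * B (approx_seq f n) (approx_seq f n) : C) @ \oo
      --> (a ^+ 2 * completion_dot f f : C) by apply: cvg_scale.
  rewrite expr2; apply: cvg_le f3 f4 _.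
  near=> n; rewrite -[X in X <= _]expr2 -seminormK -exprMn.
  by rewrite ler_pXn2r ?nnegrE ?mulr_ge0 ?seminorm_ge0.
rewrite completion_normE -(@ler_pXn2r _ 2) ?nnegrE ?seminorm_ge0 //.
rewrite seminormK /=; have [->|fN0] := eqVneq f 0.
  by rewrite linear0l exprn_ge0.
rewrite -(ler_pM2r (completion_dot_gt0 fN0)) -expr2.
by rewrite -{1}(ger0_norm (completion_dot_ge0 f)).
Unshelve. all: by end_near. Qed.

(** A Cauchy filter converges pointwise by [completion_eval_bound]; the limit
is uniformly close to functionals of [V], hence in the completion, and it is the
limit in norm by [completion_norm_le]. *)
Lemma completion_complete (F : set_system completion) :
  ProperFilter F -> cauchy F -> cvg F.
Proof.
move=> FF /cauchy_ballP Fc.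
have {}Fc e : 0 < e -> exists A : set completion,
    F A /\ forall f g, A f -> A g -> `|f - g| <= e.
  move=> e0; have [[A A'] [/= FA FA'] AA'] := Fc _ e0.
  exists (A `&` A'); split; first exact: filterI.
  move=> f g [Af _] [_ A'g].
  by have := AA' (f, g) (conj Af A'g); rewrite -ball_normE /= => /ltW.
have pointwise p : exists l : C, (fun f => f p : C) @ F --> l.
  apply/cvg_ex; apply: complex_complete; apply/cauchy_ballP => e e0.
  (* [pn p] may vanish. *)
  have p0 : 0 < pn p + 1 by rewrite ltr_wpDl ?seminorm_ge0.
  have [A [FA AA]] := Fc _ (divr_gt0 e0 p0).
  rewrite near_map2; exists (A, A) => //= -[f g] [/= Af Ag].
  rewrite -ball_normE /= -completionB.
  rewrite (le_lt_trans (completion_eval_bound _ _)) //.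
  rewrite (le_lt_trans (ler_wpM2r (seminorm_ge0 B p) (AA _ _ Af Ag))) //.
  by rewrite mulrAC ltr_pdivrMr // ltr_pM2l // ltrDl.
have [l Fl] := choice pointwise.
have closeP e A f p : F A -> (forall f g, A f -> A g -> `|f - g| <= e) -> A f ->
    `|l p - f p| <= e * pn p.
  move=> FA AA Af.
  have cl : (fun g => `|g p - f p| : C) @ F --> (`|l p - f p| : C).
    by apply: cvg_norm; apply: cvgB (Fl p) _; exact: cvg_cst.
  have cc : (fun=> e * pn p : C) @ F --> (e * pn p : C) by exact: cvg_cst.
  apply: cvg_le cl cc _.
  near=> g; rewrite -completionB (le_trans (completion_eval_bound _ _)) //.
  by rewrite ler_wpM2r ?seminorm_ge0 // AA //; near: g.
have lP : (l : V -> (R[i])^o) \in completion_pred.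
  apply/asboolP => e e0; have e2 : 0 < e / 2 by rewrite divr_gt0.
  have [A [FA AA]] := Fc _ e2; near F => f.
  have [v fv] := completion_approx f e2; exists v => p.
  rewrite -(subrKA (f p)) (le_trans (ler_normD _ _)) // [e]splitr mulrDl.
  rewrite lerD // (closeP _ A) //; by near: f.
apply/cvg_ex; exists (Completion lP); apply/cvgrPdist_le => e e0.
have [A [FA AA]] := Fc _ e0; apply: filterS (FA) => f Af.
apply: completion_norm_le => [|p]; first exact: ltW.
exact: closeP FA AA Af.
Unshelve. all: by end_near. Qed.

HB.instance Definition _ :=
  Uniform_isComplete.Build completion completion_complete.

Definition hilbert_completion : hilbertType R :=
  @Hilbert R completion completion_dot (seminormK completion_semidot).

End Completion.

(** * Hilbert spaces and unitary extensions *)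

Section HilbertSpace.
Context (R : realType) (H : hilbertType R).

Definition hilbert_semidot : semidot H :=
  @Semidot _ _ (dot H) (fun x => dnorm_ge0 (dot H) x).

Lemma hilbert_normE (x : H) : `|x| = seminorm hilbert_semidot x.
Proof.
apply/eqP; rewrite -(@eqrXn2 _ 2) ?seminorm_ge0 //.
by rewrite seminormK sqr_normE.
Qed.

Lemma dotC (x y : H) : dot H x y = (dot H y x)^*.
Proof. exact: (semidotC hilbert_semidot). Qed.

Lemma dot_le_norm (x y : H) : `|dot H x y| <= `|x| * `|y|.
Proof. by rewrite !hilbert_normE; exact: (seminorm_dot hilbert_semidot). Qed.

Lemma dot_inj (y z : H) : (forall x, dot H x y = dot H x z) -> y = z.
Proof.
move=> yz; apply/eqP; rewrite -subr_eq0 -(dnorm_eq0 (dot H)).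
by rewrite [dot H _ _](semidotBr hilbert_semidot) /= yz subrr.
Qed.

End HilbertSpace.

(** Nondegeneracy of the inner product makes any candidate the adjoint. *)
Lemma adjointE (R : realType) (H K : hilbertType R) (A : boundedOp H K) y z :
  (forall x, dot K (A x) y = dot H x z) -> adjoint A y = z.
Proof.
move=> Az; rewrite /adjoint; case: xgetP => [z' _ /= z'P|/(_ z) /=].
  by apply: dot_inj => x; rewrite -Az z'P.
by move=> /(_ Az).
Qed.

Lemma unitary_of_inverse (R : realType) (H : hilbertType R)
    (A A' : boundedOp H H) : cancel A A' -> cancel A' A ->
  (forall x y, dot H (A x) (A y) = dot H x y) -> unitary A.
Proof.
move=> AK A'K Adot x.
have adjA y : adjoint A y = A' y.
  by apply: adjointE => z; rewrite -{1}(A'K y) Adot.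
by rewrite !adjA AK A'K.
Qed.

Section UnitaryExtension.
Context (R : realType) (d : nat) (V : lmodType R[i]) (B : semidot V).
Local Notation C := (R[i] : numClosedFieldType).
Variable u : 'rV[R]_d -> V -> V.
Hypothesis u0 : forall v, u 0 v = v.
Hypothesis uD : forall s t v, u (s + t) v = u s (u t v).
Hypothesis uB : forall t v w, B (u t v) (u t w) = B v w.
Hypothesis u_cts : forall v,
  (fun t => B (u t v) v : C) @ nbhs (0 : 'rV[R]_d) --> (B v v : C).
Local Notation W := (hilbert_completion B).
Implicit Types (f g : completion B) (t : 'rV[R]_d).

Lemma u_adjoint t v w : B (u t v) w = B v (u (- t) w).
Proof. by rewrite -(uB t v) -uD subrr u0. Qed.

Lemma seminorm_u t v : seminorm B (u t v) = seminorm B v.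
Proof. by rewrite /seminorm uB. Qed.

Lemma approximates_u t f v e : approximates B f v e ->
  approximates B (fun p => f (u (- t) p)) (u t v) e.
Proof. by move=> fv p; rewrite u_adjoint -(seminorm_u (- t) p); exact: fv. Qed.

Lemma extension_subproof t f :
  (fun p => f (u (- t) p)) \in completion_pred B.
Proof.
apply/asboolP => e e0; have [v fv] := completion_approx f e0.
by exists (u t v); exact: approximates_u.
Qed.

Definition extension_fun t f : completion B :=
  Completion (extension_subproof t f).

Lemma extension_linear t : linear (extension_fun t : W -> W).
Proof. by move=> a f g; exact: completion_inj. Qed.

Definition extension_lin t : {linear W -> W} :=
  HB.pack (extension_fun t : W -> W)
    (GRing.isLinear.Build _ _ _ _ _ (extension_linear t)).

Lemma extension_dot t f g :
  completion_dot (extension_fun t f) (extension_fun t g) = completion_dot f g.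
Proof.
have gg := approx_seq_tends g.
apply: (@completion_dot_unique _ _ _ _ _ (fun n => u t (approx_seq g n))).
  by move=> e e0; near do apply: approximates_u; exact: gg.
have := @completion_dot_cvg _ _ _ f _ _ gg.
rewrite (_ : (fun n => f _) =
  (fun n => extension_fun t f (u t (approx_seq g n)))) //.
by apply/funext => n /=; rewrite -uD addNr u0.
Unshelve. all: by end_near. Qed.

Lemma extension_norm t f : `|extension_fun t f| = `|f|.
Proof. by rewrite !completion_normE /seminorm /= extension_dot. Qed.

Lemma extension_bounded t :
  exists M : R[i], forall x, `|extension_lin t x| <= M * `|x|.
Proof. by exists 1 => x; rewrite mul1r [X in X <= _]extension_norm. Qed.

Definition extension t : boundedOp W W := BoundedOp (extension_bounded t).

Lemma extension0 f : extension 0 f = f.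
Proof. by apply: completion_inj => p /=; rewrite oppr0 u0. Qed.

Lemma extensionD s t f : extension (s + t) f = extension s (extension t f).
Proof. by apply: completion_inj => p /=; rewrite opprD addrC uD. Qed.

Lemma extension_unitary t : unitary (extension t).
Proof.
apply: (unitary_of_inverse (A' := extension (- t))) => [f|f|f g].
- by rewrite -extensionD addNr extension0.
- by rewrite -extensionD subrr extension0.
- exact: extension_dot.
Qed.

Lemma extension_canonical t v :
  extension t (canonical B v) = canonical B (u t v).
Proof. by apply: completion_inj => p /=; rewrite u_adjoint. Qed.

Lemma norm_canonical v : `|canonical B v| = seminorm B v.
Proof. by rewrite completion_normE /seminorm /= completion_reproducing. Qed.

Lemma canonicalB v w : canonical B (v - w) = canonical B v - canonical B w.
Proof. by apply: completion_inj => p; rewrite completionB /= semidotBl. Qed.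

Lemma canonical_dense f e : 0 < e -> exists v, `|f - canonical B v| <= e.
Proof.
move=> e0; have [v fv] := completion_approx f e0; exists v.
apply: completion_norm_le => [|p]; [exact: ltW|exact: fv].
Qed.

(** Strong continuity at [0] on the image of [V] is weak continuity, because
[|u v - v|^2 = 2 (B v v - Re (B (u v) v))] for isometries; it passes to the
completion by density. *)
Lemma extension_cts0 f :
  (fun t => extension t f : W) @ nbhs (0 : 'rV[R]_d) --> (f : W).
Proof.
apply/cvgrPdist_lt => e e0; have e3 : 0 < e / 3 by rewrite divr_gt0.
have [v fv] := canonical_dense f e3.
have e9 : 0 < (e / 3) ^+ 2 / 2 by rewrite divr_gt0 // exprn_gt0.
move/cvgrPdist_lt: (@u_cts v) => /(_ _ e9) vv.
near=> t.
have -> : (f : W) - extension t f = (f - canonical B v)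
    + canonical B (v - u t v) - extension t (f - canonical B v).
  rewrite linearB extension_canonical canonicalB addrA subrK.
  by rewrite opprB addrA subrK.
have vtv : `|canonical B (v - u t v)| < e / 3.
  rewrite norm_canonical -(@ltr_pXn2r _ 2) ?nnegrE ?seminorm_ge0 ?ltW //.
  rewrite seminormK -[X in X < _]ger0_norm ?semidot_ge0 //.
  rewrite semidotBl !semidotBr uB (semidotC B v (u t v)).
  rewrite (le_lt_trans (ler_normB _ _)) // [X in _ < X]splitr ltrD //.
    by rewrite [X in X - _]semidotC -rmorphB norm_conjC; near: t; exact: vv.
  by rewrite distrC; near: t; exact: vv.
rewrite (le_lt_trans (ler_normB _ _)) // [X in _ + X]extension_norm.
rewrite (_ : e = e / 3 + e / 3 + e / 3); last by field.
rewrite ltr_leD // (le_lt_trans (ler_normD _ _)) //.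
by rewrite ler_ltD.
Unshelve. all: by end_near. Qed.

Lemma extension_cts f : continuous (fun t => extension t f : W).
Proof.
move=> s; apply/(@cvgrPdist_lt _ _ _ (nbhs s)) => e e0.
have ts : (fun t : 'rV[R]_d => t - s) @ nbhs s --> nbhs (0 : 'rV[R]_d).
  rewrite -(subrr s).
  by apply: (@cvgB _ _ _ (nbhs s)); [exact: cvg_id|exact: cvg_cst].
have /cvgrPdist_lt /(_ e e0) fe := @extension_cts0 f.
near=> t.
have -> : extension t f = extension s (extension (t - s) f).
  by rewrite -extensionD addrC subrK.
rewrite -linearB.
rewrite [X in X < _]extension_norm.
near: t; exact: ts fe.
Unshelve. all: by end_near. Qed.

Definition unitary_extension : unitary_rep d W :=
  UnitaryRep extension_unitary extension0 extensionD extension_cts.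

End UnitaryExtension.

(** * Finitely supported functions and positive definite kernels *)

Section FiniteSupport.
Context (G : choiceType) (C : numClosedFieldType) (H : lmodType C).

Definition finsupp_pred : {pred G -> H} :=
  fun v => `[< exists A : seq G, forall t, t \notin A -> v t = 0 >].

Lemma finsupp_submod : submod_closed finsupp_pred.
Proof.
split=> [|a v w /asboolP[A vA] /asboolP[A' wA']]; apply/asboolP.
  by exists [::].
exists (A ++ A') => t; rewrite mem_cat negb_or => /andP[tA tA'].
by rewrite -[(_ + _) t]/(a *: v t + w t) vA // wA' // scaler0 addr0.
Qed.

HB.instance Definition _ :=
  GRing.isSubmodClosed.Build _ _ finsupp_pred finsupp_submod.

Record finsupp := Finsupp {
  finsupp_fun :> G -> H;
  finsuppP : finsupp_fun \in finsupp_pred }.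

HB.instance Definition _ := [isSub for finsupp_fun].
HB.instance Definition _ := [Choice of finsupp by <:].
HB.instance Definition _ := [SubChoice_isSubLmodule of finsupp by <:].

Implicit Types (v w z : finsupp).

Lemma finsupp_inj v w : v =1 w -> v = w.
Proof. by move=> vw; apply/val_inj/funext. Qed.

Lemma finsuppDZ a v w t : (a *: v + w) t = a *: v t + w t.
Proof. by []. Qed.

(** A duplicate-free list outside of which [v] vanishes, so that sums over the
support can be computed on any such list ([covers_sum]). *)
Definition covers (A : seq G) v := uniq A /\ forall t, t \notin A -> v t = 0.

Lemma finsupp_cover v : exists A, covers A v.
Proof.
have /asboolP[A vA] := finsuppP v; exists (undup A); split.
  exact: undup_uniq.
by move=> t; rewrite mem_undup => /vA.
Qed.

Lemma finsupp_cover2 v w : exists A, covers A v /\ covers A w.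
Proof.
have [A [_ vA]] := finsupp_cover v; have [A' [_ wA']] := finsupp_cover w.
exists (undup (A ++ A')).
split; split=> [|t]; rewrite ?undup_uniq // mem_undup mem_cat negb_or.
  by move=> /andP[/vA].
by move=> /andP[_ /wA'].
Qed.

Definition supp v : seq G := sval (cid (finsupp_cover v)).

Lemma covers_supp v : covers (supp v) v.
Proof. by rewrite /supp; case: cid. Qed.

Lemma covers_sum A A' v (F : G -> C) : covers A v -> covers A' v ->
  (forall t, v t = 0 -> F t = 0) -> \sum_(t <- A) F t = \sum_(t <- A') F t.
Proof.
move=> [uA vA] [uA' vA'] F0.
have nz D : \sum_(t <- D) F t = \sum_(t <- [seq t <- D | v t != 0]) F t.
  rewrite big_filter [LHS](bigID (fun t => v t != 0)) /=.
  by rewrite [X in _ + X]big1 ?addr0 // => t; rewrite negbK => /eqP/F0.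
rewrite (nz A) (nz A'); apply/perm_big/uniq_perm; rewrite ?filter_uniq // => t.
rewrite !mem_filter; case: eqVneq => //= /eqP vt.
have [tA|tA] := boolP (t \in A); last by have := vA _ tA.
by have [//|tA'] := boolP (t \in A'); have := vA' _ tA'.
Qed.

Variable k : G -> G -> H -> H -> C.
Hypothesis k_linear : forall t s y a x x',
  k t s (a *: x + x') y = a * k t s x y + k t s x' y.
Hypothesis k_herm : forall t s x y, k t s x y = (k s t y x)^*.
Hypothesis k_ge0 : forall (A : seq G) (x : G -> H),
  0 <= \sum_(t <- A) \sum_(s <- A) k t s (x t) (x s).

Definition kernel_form v w :=
  \sum_(t <- supp v) \sum_(s <- supp w) k t s (v t) (w s).

Lemma k0l t s y : k t s 0 y = 0.
Proof.
have := k_linear t s y 1 0 0; rewrite scale1r mul1r addr0 => /eqP.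
by rewrite -subr_eq0 opprD addrA subrr add0r oppr_eq0 => /eqP.
Qed.

Lemma k0r t s x : k t s x 0 = 0.
Proof. by rewrite k_herm k0l rmorph0. Qed.

Lemma kernel_formE A A' v w : covers A v -> covers A' w ->
  kernel_form v w = \sum_(t <- A) \sum_(s <- A') k t s (v t) (w s).
Proof.
move=> Av Aw; rewrite /kernel_form (covers_sum (covers_supp v) Av); last first.
  by move=> t vt; apply: big1 => s _; rewrite vt k0l.
apply: eq_bigr => t _; apply: covers_sum (covers_supp w) Aw _ => s ->.
exact: k0r.
Qed.

Lemma kernel_form_linear a v w z :
  kernel_form (a *: v + w) z = a * kernel_form v z + kernel_form w z.
Proof.
have [A [vA wA]] := finsupp_cover2 v w; have zA := covers_supp z.
have avwA : covers A (a *: v + w).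
  case: vA wA => uA vA [_ wA]; split=> // t tA.
  by rewrite finsuppDZ vA // wA // scaler0 addr0.
rewrite (kernel_formE avwA zA) (kernel_formE vA zA) (kernel_formE wA zA).
rewrite mulr_sumr -big_split; apply: eq_bigr => t _ /=.
rewrite mulr_sumr -big_split; apply: eq_bigr => s _ /=.
exact: k_linear.
Qed.

Lemma kernel_form_herm v w : kernel_form v w = (kernel_form w v)^*.
Proof.
rewrite /kernel_form rmorph_sum exchange_big; apply: eq_bigr => t _ /=.
by rewrite rmorph_sum; apply: eq_bigr => s _; exact: k_herm.
Qed.

Lemma kernel_form_bilinear : bilinear_for
  (GRing.Scale.Law.clone _ _ *%R _) (GRing.Scale.Law.clone _ _ (conjC \; *%R) _)
  kernel_form.
Proof.
split=> [z a v w|z a v w]; first exact: kernel_form_linear.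
by rewrite !(kernel_form_herm z) kernel_form_linear rmorphD rmorphM.
Qed.

Lemma kernel_form_hermitian v w :
  kernel_form v w = (-1) ^+ false * (kernel_form w v)^*.
Proof. by rewrite expr0 mul1r kernel_form_herm. Qed.

Definition kernel_hermitian : {hermitian_sym finsupp for conjC} :=
  HB.pack kernel_form (bilinear_isBilinear.Build C finsupp finsupp
    C *%R (conjC \; *%R) kernel_form kernel_form_bilinear)
   (isHermitianSesquilinear.Build C finsupp
  false conjC kernel_form kernel_form_hermitian).

Lemma kernel_form_ge0 v : 0 <= kernel_hermitian v v.
Proof. exact: k_ge0. Qed.

Definition kernel_semidot : semidot finsupp := Semidot kernel_form_ge0.

End FiniteSupport.

(** * Naimark's dilation theorem *)

Section Naimark.
Context (R : realType) (d : nat) (H : hilbertType R).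
Local Notation C := (R[i] : numClosedFieldType).
Variable kappa : 'rV[R]_d -> H -> H -> R[i].
Hypothesis kappa_linear : forall t y a x x',
  kappa t (a *: x + x') y = a * kappa t x y + kappa t x' y.
Hypothesis kappa_herm : forall t x y, kappa t x y = (kappa (- t) y x)^*.
Hypothesis kappa_ge0 : forall (A : seq 'rV[R]_d) (x : 'rV[R]_d -> H),
  0 <= \sum_(t <- A) \sum_(s <- A) kappa (t - s) (x t) (x s).
Hypothesis kappa_cts : forall x y, continuous (fun t => kappa t x y : C).
Hypothesis kappa0 : forall x y, kappa 0 x y = dot H x y.

Local Notation V := (finsupp 'rV[R]_d H).
Implicit Types (v w : V) (t s : 'rV[R]_d).

Let k t s := kappa (t - s).

Let k_herm t s x y : k t s x y = (k s t y x)^*.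
Proof. by rewrite /k kappa_herm opprB. Qed.

Let B : semidot V :=
  kernel_semidot (fun t s => kappa_linear (t - s)) k_herm kappa_ge0.

Let BE A A' v w : covers A v -> covers A' w ->
  B v w = \sum_(t <- A) \sum_(s <- A') kappa (t - s) (v t) (w s).
Proof.
move=> vA wA'.
exact: (kernel_formE (fun t s => kappa_linear (t - s)) k_herm).
Qed.

Let mem_translate tau (A : seq 'rV[R]_d) t :
  (t \in [seq s + tau | s <- A]) = (t - tau \in A).
Proof.
rewrite -{1}(subrK tau t) (@mem_map _ _ (fun s => s + tau)) //; exact: addIr.
Qed.

Lemma translate_subproof tau v :
  (fun t => v (t - tau)) \in @finsupp_pred 'rV[R]_d C H.
Proof.
have [_ vA] := covers_supp v.
apply/asboolP; exists [seq t + tau | t <- supp v] => t.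
by rewrite mem_translate => /vA.
Qed.

Definition translate tau v : V := Finsupp (translate_subproof tau v).

Lemma covers_translate tau A v : covers A v ->
  covers [seq t + tau | t <- A] (translate tau v).
Proof.
move=> [uA vA]; split; first by rewrite map_inj_uniq //; exact: addIr.
by move=> t; rewrite mem_translate => /vA.
Qed.

Lemma translate0 v : translate 0 v = v.
Proof. by apply: finsupp_inj => t /=; rewrite subr0. Qed.

Lemma translateD s t v : translate (s + t) v = translate s (translate t v).
Proof. by apply: finsupp_inj => p /=; rewrite opprD addrA. Qed.

Lemma translate_form1 tau v : B (translate tau v) v =
  \sum_(t <- supp v) \sum_(s <- supp v) kappa (t + tau - s) (v t) (v s).
Proof.
have vA := covers_supp v; rewrite (BE (covers_translate tau vA) vA) big_map.
by apply: eq_bigr => t _; apply: eq_bigr => s _; rewrite /= addrK.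
Qed.

Lemma translate_form tau v w : B (translate tau v) (translate tau w) = B v w.
Proof.
have vA := covers_supp v; have wA := covers_supp w.
rewrite (BE (covers_translate tau vA) (covers_translate tau wA)) (BE vA wA).
rewrite big_map; apply: eq_bigr => t _; rewrite big_map; apply: eq_bigr => s _.
by rewrite /= !addrK opprD addrACA subrr addr0.
Qed.

Lemma translate_cts v :
  (fun t => B (translate t v) v : C) @ nbhs (0 : 'rV[R]_d) --> (B v v : C).
Proof.
have sum_cts (A : seq 'rV[R]_d) (F : 'rV[R]_d -> 'rV[R]_d -> C) :
    (forall s, continuous (F s)) -> continuous (fun t => \sum_(s <- A) F s t).
  move=> Fc; apply: continuous_big => [|s _]; last exact: Fc.
  exact: add_continuous.
have -> : (fun t => B (translate t v) v) = (fun tau =>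
    \sum_(t <- supp v) \sum_(s <- supp v) kappa (t + tau - s) (v t) (v s)).
  by apply/funext => tau; rewrite translate_form1.
rewrite -[X in B X v]translate0 translate_form1.
apply: (sum_cts) => t; apply: (sum_cts) => s tau.
apply: (@continuous_comp _ _ _ (fun tau => t + tau - s)
  (fun tau => kappa tau (v t) (v s) : C)); last exact: kappa_cts.
apply: (@cvgB _ _ _ (nbhs _)); last exact: cvg_cst.
by apply: (@cvgD _ _ _ (nbhs _)); [exact: cvg_cst|exact: cvg_id].
Qed.

Let U : unitary_rep d (hilbert_completion B) :=
  unitary_extension translate0 translateD translate_form translate_cts.

Lemma delta_subproof x : (fun t => if t == 0 then x else 0) \in
  @finsupp_pred 'rV[R]_d C H.
Proof. by apply/asboolP; exists [:: 0] => t; rewrite inE; case: eqP. Qed.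

Definition delta x : V := Finsupp (delta_subproof x).

Lemma delta_covers x : covers [:: 0] (delta x).
Proof. by split=> // t; rewrite inE /=; case: eqP. Qed.

Lemma delta_form tau x y :
  B (translate tau (delta x)) (delta y) = kappa tau x y.
Proof.
rewrite (BE (covers_translate tau (delta_covers x)) (delta_covers y)).
rewrite big_map !big_seq1 /= add0r.
by rewrite subrr !eqxx subr0.
Qed.

Lemma embedding_linear :
  linear (fun x => canonical B (delta x) : hilbert_completion B).
Proof.
move=> a x y; have -> : delta (a *: x + y) = a *: delta x + delta y.
  apply: finsupp_inj => t; rewrite finsuppDZ /=.
  by case: ifP => // _; rewrite scaler0 addr0.
apply: completion_inj => p; rewrite completionPZ.
have := semidotDl B (a *: delta x) (delta y) p.
by rewrite semidotZl.
Qed.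

Let r_lin : {linear H -> hilbert_completion B} :=
  HB.pack (fun x => canonical B (delta x) : hilbert_completion B)
    (GRing.isLinear.Build _ _ _ _ _ embedding_linear).

Lemma embedding_bounded : exists M : R[i], forall x, `|r_lin x| <= M * `|x|.
Proof.
exists 1 => x; rewrite mul1r [X in X <= _]norm_canonical hilbert_normE.
by rewrite /seminorm -[X in B X _]translate0 delta_form kappa0.
Qed.

Let r : boundedOp H (hilbert_completion B) := BoundedOp embedding_bounded.

(** Translations of the finitely supported functions preserve the form defined
by [kappa], so that they extend to a unitary representation on the completion;
the values of [kappa] are its coefficients at the functions [delta x]. *)
Theorem naimark : exists (H' : hilbertType R) (U : unitary_rep d H')
    (r : boundedOp H H'), forall t x y, dot H' (U t (r x)) (r y) = kappa t x y.
Proof.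
exists (hilbert_completion B), U, r => t x y.
have -> : U t (r x) = canonical B (translate t (delta x)).
  exact: extension_canonical.
rewrite -delta_form; exact: completion_reproducing.
Qed.

End Naimark.

(** * Brehmer's positivity criterion *)

Section Brehmer.
Context (C : numDomainType) (H : zmodType) (I : Type) (S : I -> H -> H).
Hypothesis S0 : forall i, S i 0 = 0.
Hypothesis SC : forall i j x, S i (S j x) = S j (S i x).
Implicit Types (B : H -> H -> C) (L : seq I) (x y : H).

Definition defect i B x y := B x y - B (S i x) (S i y).

(** Unfolding the recursion, the forms obtained from [B] by taking defects
along an arbitrary sublist of [L] have to be nonnegative. *)
Fixpoint brehmer L B : Prop :=
  if L is i :: L' then brehmer L' B /\ brehmer L' (defect i B)
  else forall x, 0 <= B x x.

Definition biadditive B :=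
  (forall y, {morph B^~ y : x x' / x + x'}) /\
  (forall x, {morph B x : y y' / y + y'}).

Definition power L (n : I -> nat) x :=
  foldr (fun i y => iter (n i) (S i) y) x L.

Lemma iterC i j m n x :
  iter m (S i) (iter n (S j) x) = iter n (S j) (iter m (S i) x).
Proof.
have one k y : S i (iter k (S j) y) = iter k (S j) (S i y).
  by elim: k => //= k <-; rewrite SC.
by elim: m => //= m ->; rewrite one.
Qed.

Lemma iter0 i n : iter n (S i) 0 = 0.
Proof. by elim: n => //= n ->. Qed.

Lemma power_iter L n i m x :
  power L n (iter m (S i) x) = iter m (S i) (power L n x).
Proof. by elim: L => //= j L ->; rewrite iterC. Qed.

Lemma power0 L n : power L n 0 = 0.
Proof. by elim: L => //= j L ->; rewrite iter0. Qed.

Lemma biadditive0 B : biadditive B ->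
  (forall y, B 0 y = 0) /\ forall x, B x 0 = 0.
Proof.
have idem (a : C) : a = a + a -> a = 0.
  move/eqP; rewrite -subr_eq0 opprD addrA subrr add0r oppr_eq0; exact: eqP.
move=> [Bl Br]; split=> z; apply: idem.
  by rewrite -Bl addr0.
by rewrite -Br addr0.
Qed.

Lemma biadditive_defect B i : {morph S i : x y / x + y} -> biadditive B ->
  biadditive (defect i B).
Proof.
move=> SD [Bl Br]; split=> z x y; rewrite /defect SD ?Bl ?Br opprD addrACA //.
Qed.

(** Moving a pair of powers [(a, b)] down to [(a - b, b - a)] takes [min a b]
steps, and each step is one defect.  The sum is written over a fixed range [N]
with a condition that splits as a product over the two arguments, so that each
term is again a kernel. *)
Lemma defect_telescope B i a b N x y : (minn a b <= N)%N ->
  B (iter (a - b) (S i) x) (iter (b - a) (S i) y) =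
  B (iter a (S i) x) (iter b (S i) y) +
  \sum_(0 <= s < N) (if (s < a)%N && (s < b)%N then
     defect i B (iter (a - s.+1) (S i) x) (iter (b - s.+1) (S i) y) else 0).
Proof.
set c := minn a b => cN.
pose f s := B (iter (a - s) (S i) x) (iter (b - s) (S i) y).
have -> : B (iter (a - b) (S i) x) (iter (b - a) (S i) y) = f c.
  by rewrite /f /c; congr (B (iter _ _ _) (iter _ _ _)); lia.
rewrite -big_mkcond (eq_bigl (fun s => s < c)%N); last first.
  by move=> s; rewrite leq_min.
rewrite -(big_nat_widen 0 c N predT) //.
rewrite (eq_big_nat _ _ (F2 := fun s => f s.+1 - f s)) => [|s /andP[_ sc]].
  by rewrite telescope_sumr // /f !subn0 addrCA subrr addr0.
have [sa sb] : (s < a)%N /\ (s < b)%N by move: sc; rewrite leq_min => /andP.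
by rewrite /defect /f -!iterS -!subSn // !subSS.
Qed.

(** Induction on the list of coordinates.  By [defect_telescope], the kernel of
[B] for [i :: L] is the kernel of [B] for [L] at the points moved by all their
[i]-th powers, plus kernels of the defect of [B] for [L] at points moved by the
remaining powers, where the points with too small an exponent are replaced
by [0]. *)
Theorem brehmer_kernel_ge0 L B : (forall i, {morph S i : x y / x + y}) ->
  biadditive B -> brehmer L B -> forall (J : eqType) (A : seq J)
    (n : J -> I -> nat) (x : J -> H),
  0 <= \sum_(j <- A) \sum_(k <- A)
    B (power L (fun i => n j i - n k i)%N (x j))
      (power L (fun i => n k i - n j i)%N (x k)).
Proof.
move=> SD; elim: L B => [|i L IH] B Badd /=.
  move=> B0 J A _ x; have [B0l B0r] := biadditive0 Badd.
  have sumr y : \sum_(k <- A) B y (x k) = B y (\sum_(k <- A) x k).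
    by rewrite (big_morph (B y) (Badd.2 y) (B0r y)).
  under eq_bigr do rewrite sumr.
  by rewrite -(big_morph (B^~ _) (Badd.1 _) (B0l _)).
move=> [BL DL] J A n x.
pose N := (\max_(j <- A) n j i)%N.
pose y s j := if (s < n j i)%N then iter (n j i - s.+1) (S i) (x j) else 0.
pose ker B' (z : J -> H) := \sum_(j <- A) \sum_(k <- A)
    B' (power L (fun i => n j i - n k i)%N (z j))
      (power L (fun i => n k i - n j i)%N (z k)).
have Dadd := biadditive_defect (SD i) Badd.
have [D0l D0r] := biadditive0 Dadd.
suff -> : \sum_(j <- A) \sum_(k <- A)
    B (iter (n j i - n k i) (S i) (power L (fun i => n j i - n k i)%N (x j)))
      (iter (n k i - n j i) (S i) (power L (fun i => n k i - n j i)%N (x k))) =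
    ker B (fun j => iter (n j i) (S i) (x j)) +
    \sum_(0 <= s < N) ker (defect i B) (y s).
  by rewrite addr_ge0 ?IH // sumr_ge0 // => s _; exact: IH.
rewrite [X in _ + X]exchange_big -big_split /=.
apply: eq_big_seq => j jA; rewrite [X in _ + X]exchange_big -big_split /=.
apply: eq_big_seq => k kA.
rewrite (@defect_telescope _ _ _ _ N); last first.
  by rewrite geq_min leq_bigmax_seq.
congr (_ + _); first by rewrite !power_iter.
apply: eq_bigr => s _; rewrite /y.
case: (s < n j i)%N => /=; last by rewrite power0 D0l.
by case: (s < n k i)%N => /=; rewrite ?power0 ?D0r // !power_iter.
Qed.

End Brehmer.

(** * Uniform boundedness *)

Section UniformBoundedness.
Context (R : realType).
Context (V : completeNormedModType R[i]) (W : normedModType R[i]).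
Variable f : nat -> {linear V -> W}.
Hypothesis f_bounded :
  forall n, exists M : R[i], forall x, `|f n x| <= M * `|x|.
Hypothesis f_pointwise : forall x, exists M : R[i], forall n, `|f n x| <= M.

Let unbounded := forall M : R[i], 0 <= M -> exists n x, M * `|x| < `|f n x|.

(** Some [f n] expands a vector of size [r / 2] to norm at least [k.+1]; it does
so at one of the points [x + y] and [x - y], as [2 f n y] is the difference of
the two values, and by continuity its norm stays above [k] on a smaller ball. *)
Lemma shrinking_ball (k : nat) (x : V) (r : R[i]) : unbounded -> 0 < r ->
  exists x' r', [/\ 0 < r', r' <= r / 2, `|x' - x| <= r / 2 &
    exists n, forall z, `|z - x'| <= r' -> k%:R <= `|f n z|].
Proof.
move=> unb r0; have r2 : 0 < r / 2 by rewrite divr_gt0.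
have [n [y ny]] := unb (k.+1%:R / (r / 2)) (divr_ge0 (ler0n _ _) (ltW r2)).
have y0 : 0 < `|y|.
  rewrite normr_gt0; apply: contraTneq ny => ->.
  by rewrite linear0 !normr0 mulr0 ltxx.
pose a := r / 2 / `|y|; have a0 : 0 < a by rewrite divr_gt0.
have y1 : `|a *: y| = r / 2 by rewrite normrZ gtr0_norm // mulfVK ?gt_eqF.
have fy1 : k.+1%:R < `|f n (a *: y)|.
  rewrite linearZ normrZ gtr0_norm //; move: ny; rewrite -(ltr_pM2l a0).
  congr (_ < _); rewrite /a; field; rewrite !gt_eqF //.
have [x' [xx' fx']] : exists x', `|x' - x| = r / 2 /\ k.+1%:R <= `|f n x'|.
  have [fp|fp] := real_leP (@realn R[i] k.+1) (normr_real (f n (x + a *: y))).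
    by exists (x + a *: y); rewrite addrAC subrr add0r y1.
  exists (x - a *: y); rewrite addrAC subrr add0r normrN y1; split=> //.
  rewrite real_leNgt ?realn // ?normr_real //; apply/negP => fm.
  suff le : k.+1%:R + k.+1%:R <= `|f n (x + a *: y)| + `|f n (x - a *: y)|.
    by have := le_lt_trans le (ltrD fp fm); rewrite ltxx.
  rewrite (le_trans _ (ler_normB _ _)) // -linearB.
  have -> : x + a *: y - (x - a *: y) = 2%:R *: (a *: y).
    by rewrite opprB addrC addrA subrK -mulr2n scaler_nat.
  rewrite linearZ normrZ normr_nat.
  by rewrite -[X in X <= _]mulr2n -[X in X <= _]mulr_natl ler_pM2l // ltW.
have [M fM] := f_bounded n.
have M0 : 0 <= M by rewrite -(pmulr_lge0 _ y0) (le_trans _ (fM y)).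
pose c := 1 + M * (r / 2).
have c0 : 0 < c by rewrite ltr_pwDl // mulr_ge0 // ltW.
(* This radius is at most [r / 2], and [M] times it is at most [1]. *)
exists x', (r / 2 / c); split=> //.
- by rewrite divr_gt0.
- by rewrite ler_pdivrMr // ler_peMr ?(ltW r2) // lerDl mulr_ge0 ?(ltW r2).
- by rewrite xx'.
exists n => z zx'.
have fz : `|f n (z - x')| <= 1.
  rewrite (le_trans (fM _)) // (le_trans (ler_wpM2l M0 zx'))  // mulrA.
  by rewrite ler_pdivrMr // mul1r /c lerDr.
rewrite -(lerD2r 1) natr1 (le_trans fx') //.
rewrite -[X in f n X](subKr z) linearB (le_trans (ler_normB _ _)) // lerD2l //.
Qed.

(** If the norms were unbounded, iterating [shrinking_ball] would produce nested
balls whose common point contradicts the pointwise bound. *)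
Theorem uniform_boundedness : exists M : R[i], forall n x, `|f n x| <= M * `|x|.
Proof.
apply: contrapT => nM.
have unb : unbounded.
  move=> M M0; apply: contrapT => nMx; apply: nM; exists M => n x.
  rewrite real_leNgt ?normr_real ?realM ?ger0_real //; apply/negP => lt.
  by apply: nMx; exists n, x.
pose state := {p : V * R[i] | 0 < p.2}.
have step (k : nat) (p : state) : {q : state | [/\ (sval q).2 <= (sval p).2 / 2,
    `|(sval q).1 - (sval p).1| <= (sval p).2 / 2 &
    exists n, forall z, `|z - (sval q).1| <= (sval q).2 -> k%:R <= `|f n z|]}.
  apply: cid; case: p => -[x r] /= r0.
  have [x' [r' [r'0 rr' xx' fz]]] := shrinking_ball k x unb r0.
  by exists (exist _ (x', r') r'0).
pose s := fix s k := if k is k'.+1 then sval (step k' (s k'))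
  else exist _ (0, 1) ltr01 : state.
pose x k := (sval (s k)).1; pose r k := (sval (s k)).2.
have r_gt0 k : 0 < r k by rewrite /r; case: (s k).
have rS k : r k.+1 <= r k / 2 by rewrite /r /=; have [] := svalP (step k (s k)).
have xS k : `|x k.+1 - x k| <= r k / 2.
  by rewrite /x /r /=; have [] := svalP (step k (s k)).
have fx k : exists n, forall z, `|z - x k.+1| <= r k.+1 -> k%:R <= `|f n z|.
  by rewrite /x /r /=; have [] := svalP (step k (s k)).
have dist k m : `|x (k + m)%N - x k| <= r k - r (k + m)%N.
  elim: m => [|m IH]; first by rewrite addn0 !subrr normr0.
  rewrite addnS -(subrKA (x (k + m)%N)) (le_trans (ler_normD _ _)) //.
  rewrite -[X in _ <= X](subrKA (r (k + m)%N)) [X in _ <= X]addrC lerD //.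
  rewrite (le_trans (xS _)) // lerBrDr -lerBrDl.
  rewrite {1}[r (k + m)%N]splitr addrK; exact: rS.
have rk k : r k <= k.+1%:R^-1.
  have : r k <= (2 ^ k)%:R^-1.
    elim: k => [|k IH]; first by rewrite invr1.
    rewrite expnSr natrM invfM (le_trans (rS k)) // ler_pM2r // invr_gt0.
  move=> /le_trans -> //; rewrite lef_pV2 ?posrE ?ltr0n ?expn_gt0 // ler_nat.
  exact: ltn_expl.
have /cvg_ex [z xz] : cvg (x n @[n --> \oo]).
  apply: cauchy_cvg; apply/cauchy_ballP => e e0.
  have e2 : 0 < e / 2 by rewrite divr_gt0.
  have [N _ Ne] := invn_near (divr_gt0 e2 (@ltr0Sn _ 1)).
  rewrite near_map2; exists ([set n | (N <= n)%N], [set n | (N <= n)%N]).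
    by split; exists N.
  move=> [a b] /= [Na Nb]; rewrite -ball_normE /= -(subrKA (x N)).
  rewrite (le_lt_trans (ler_normD _ _)) //.
  have near c : (N <= c)%N -> `|x c - x N| <= e / 2 / 2.
    move=> Nc; rewrite -(subnKC Nc) (le_trans (dist _ _)) //.
    rewrite (le_trans _ (Ne N (leqnn N))) // (le_trans _ (rk N)) //.
    by rewrite gerBl ltW.
  apply: (@le_lt_trans _ _ (e / 2)); last first.
    by rewrite gtr_pMr // invf_lt1 // ltr1n.
  by rewrite [e / 2]splitr lerD ?near // distrC near.
have zx k : `|z - x k| <= r k.
  apply: (@cvg_le _ _ \oo _ (fun n => `|x n - x k|) (fun=> r k)).
  - by apply: cvg_norm; apply: cvgB => //; exact: cvg_cst.
  - exact: cvg_cst.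
  - exists k => // n /= kn; rewrite -(subnKC kn) (le_trans (dist _ _)) //.
    by rewrite gerBl ltW.
have [M fM] := f_pointwise z.
have M0 : 0 <= M := le_trans (normr_ge0 _) (fM 0%N).
have M1 : 0 < (M + 1)^-1 by rewrite invr_gt0 ltr_wpDl.
have [N _ NM] := invn_near M1.
have {NM} := NM N (leqnn N); rewrite /= lef_pV2 ?posrE ?ltr_wpDl //.
have [n fn] := fx N.+1; have := le_trans (fn z (zx _)) (fM n) => le1 le2.
have := le_trans le2 le1.
by rewrite -subr_le0 addrAC subrr add0r ler10.
Qed.

End UniformBoundedness.

(** * Damped operators close to the identity *)

Section NearlyScalar.
Context (R : realType) (H : hilbertType R).
Context (I : Type) (T : I -> {linear H -> H}).
Variables (q m delta : R[i]).
Hypothesis q0 : 0 < q.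
Hypothesis q1 : q < 1.
Hypothesis Tm : forall i x, `|T i x - x| <= m * `|x|.
Hypothesis delta_ge0 : 0 <= delta.
Hypothesis q_delta : q ^+ 2 * (2 * m * (2 + m)) <= (1 - q ^+ 2) * delta.

Let S i (x : H) := q *: T i x.

(** Being [e]-close to [c] times the inner product, together with the symmetries
that taking defects preserves.  The scale [c] stands apart because each defect
shrinks it by [1 - q ^+ 2], while [e] only grows by [delta]. *)
Record near_dot (c e : R[i]) (B : H -> H -> R[i]) : Prop := NearDot {
  near_dotD : biadditive B;
  near_dotC : forall x y, B x y = (B y x)^*;
  near_dotZ : forall x y, B (q *: x) (q *: y) = q ^+ 2 * B x y;
  near_dotP : forall x y, `|B x y - c * dot H x y| <= c * e * (`|x| * `|y|) }.

(** With [S = q T], the defect is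
[(1 - q^2) B (x, y) - q^2 (B (T x, T y) - B (x, y))].  The second term is small
because [T] is close to the identity; divided by [1 - q^2], it contributes
[delta]. *)
Lemma near_dot_defect c e i B : 0 < c -> 0 <= e -> e <= 1 -> near_dot c e B ->
  near_dot (c * (1 - q ^+ 2)) (e + delta) (defect S i B).
Proof.
move=> c0 e0 e1 [BD BC BZ BP].
have defE x y : defect S i B x y = B x y - q ^+ 2 * B (T i x) (T i y).
  by rewrite /defect /S BZ.
have B_bound x y : `|B x y| <= 2 * c * (`|x| * `|y|).
  rewrite -[B x y](subrK (c * dot H x y)) (le_trans (ler_normD _ _)) //.
  rewrite (le_trans (lerD (BP _ _) (lexx _))) // normrM (gtr0_norm c0).
  rewrite mulr_natl mulr2n -!mulrA !mulrDl lerD //.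
    by rewrite ler_pM2l // ler_piMl // mulr_ge0.
  by rewrite ler_pM2l // dot_le_norm.
have T_bound x : `|T i x| <= (1 + m) * `|x|.
  rewrite -[T i x](subrK x) (le_trans (ler_normD _ _)) // addrC mulrDl mul1r.
  by rewrite lerD.
have BN x y z : B (x - z) y = B x y - B z y.
  by rewrite -[in RHS](subrK z x) BD.1 addrK.
have BNr x y z : B x (y - z) = B x y - B x z.
  by rewrite -[in RHS](subrK z y) BD.2 addrK.
have BT x y : `|B (T i x) (T i y) - B x y| <=
    2 * c * (m * (2 + m)) * (`|x| * `|y|).
  rewrite (_ : _ - _ = B (T i x - x) (T i y) + B x (T i y - y)); last first.
    by rewrite BN BNr addrA subrK.
  rewrite (le_trans (ler_normD _ _)) //.
  rewrite (le_trans (lerD (B_bound _ _) (B_bound _ _))) // -mulrDr -!mulrA.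
  rewrite !ler_pM2l //.
  have h1 : `|T i x - x| * `|T i y| <= m * `|x| * ((1 + m) * `|y|).
    by rewrite ler_pM.
  have h2 : `|x| * `|T i y - y| <= `|x| * (m * `|y|) by rewrite ler_wpM2l.
  rewrite (le_trans (lerD h1 h2)) //.
  move: `|x| `|y| => a b; rewrite le_eqVlt; apply/orP; left; apply/eqP; ring.
split.
- by apply: biadditive_defect => // x y; rewrite /S linearD scalerDr.
- by move=> x y; rewrite !defE (BC x y) (BC (T i x)) rmorphB rmorphM rmorphXn /=
    (geC0_conj (ltW q0)).
- move=> x y; have TZ z : T i (q *: z) = q *: T i z by rewrite linearZ.
  by rewrite !defE !TZ !BZ; ring.
move=> x y; rewrite defE.
rewrite (_ : _ - _ = (1 - q ^+ 2) * (B x y - c * dot H x y)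
   - q ^+ 2 * (B (T i x) (T i y) - B x y)); last by ring.
have p0 : 0 < 1 - q ^+ 2 by rewrite subr_gt0 expr_lt1 // ltW.
rewrite (le_trans (ler_normB _ _)) // normrM (gtr0_norm p0).
rewrite normrM (gtr0_norm (exprn_gt0 2 q0)) mulrDr mulrDl lerD //.
  rewrite (_ : c * _ * e * _ = (1 - q ^+ 2) * (c * e * (`|x| * `|y|))).
    by rewrite ler_pM2l.
  by ring.
apply: le_trans (ler_wpM2l (exprn_ge0 2 (ltW q0)) (BT x y)) _.
have cN : 0 <= c * (`|x| * `|y|) by rewrite !mulr_ge0 // ltW.
by have := ler_wpM2r cN q_delta; congr (_ <= _); ring.
Qed.

Lemma near_dot_brehmer L c e B : 0 < c -> 0 <= e ->
  e + (size L)%:R * delta <= 1 -> near_dot c e B -> brehmer S L B.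
Proof.
elim: L c e B => [|i L IH] c e B c0 e0 /= e1 nB.
  move=> x; have [_ BC _ /(_ x x) BP] := nB.
  rewrite mul0r addr0 in e1.
  have Bre : B x x \is Num.real by apply/CrealP; rewrite -BC.
  have xx : dot H x x = `|x| ^+ 2 by rewrite sqr_normE.
  have cxre : c * dot H x x \is Num.real.
    by rewrite xx; apply: realM; apply: ger0_real; rewrite ?exprn_ge0 ?(ltW c0).
  pose N := c * e * (`|x| * `|x|).
  have /andP[+ _] : - N <= B x x - c * dot H x x <= N.
    by rewrite -real_ler_norml // realB.
  rewrite lerBrDr; apply: le_trans; rewrite /N addrC subr_ge0 xx expr2.
  by rewrite -mulrA ler_pM2l // ler_piMl // mulr_ge0.
have p0 : 0 < 1 - q ^+ 2 by rewrite subr_gt0 expr_lt1 // ltW.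
have le1 : e + delta + (size L)%:R * delta <= 1.
  by move: e1; rewrite -addrA -natr1 mulrDl mul1r [delta + _]addrC.
split.
  apply: (IH c e) => //; apply: le_trans e1.
  by rewrite lerD2l ler_wpM2r // ler_nat.
apply: (IH (c * (1 - q ^+ 2)) (e + delta)) => //.
- by rewrite mulr_gt0.
- by rewrite addr_ge0.
apply: near_dot_defect => //; apply: le_trans e1.
by rewrite lerDl mulr_ge0.
Qed.

Lemma near_dot_dot : near_dot 1 0 (dot H).
Proof.
split.
- split=> [y x x'|x y y'].
    exact: (semidotDl (hilbert_semidot H)).
  exact: (semidotDr (hilbert_semidot H)).
- by move=> x y; exact: dotC.
- move=> x y; rewrite (semidotZl (hilbert_semidot H)).
  rewrite (semidotZr (hilbert_semidot H)) (geC0_conj (ltW q0)) mulrA expr2 //.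
- by move=> x y; rewrite mul1r subrr normr0 mulr0 mul0r.
Qed.

Theorem brehmer_dot L : (size L)%:R * delta <= 1 -> brehmer S L (dot H).
Proof.
move=> L1; apply: near_dot_brehmer near_dot_dot => //.
by rewrite add0r.
Qed.

End NearlyScalar.

(** * Limits of inner products and dyadic difference quotients *)

Section DotLimits.
Context (R : realType) (H : hilbertType R).
Local Notation C := (R[i] : numClosedFieldType).

Lemma cvg_dot T (F : set_system T) (FF : ProperFilter F)
    (f g : T -> H) (a b : H) : f @ F --> a -> g @ F --> b ->
  (fun x => dot H (f x) (g x) : C) @ F --> (dot H a b : C).
Proof.
move=> fa gb.
have f0 : (fun x => `|a - f x| : C) @ F --> (0 : C).
  rewrite -(@normr0 _ H) -(subrr a); apply: cvg_norm.
  by apply: cvgB fa; exact: cvg_cst.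
have g0 : (fun x => `|b - g x| : C) @ F --> (0 : C).
  rewrite -(@normr0 _ H) -(subrr b); apply: cvg_norm.
  by apply: cvgB gb; exact: cvg_cst.
have b1 : (fun x => `|a - f x| * `|g x| : C) @ F --> (0 * `|b| : C).
  by apply: cvgM f0 _; exact: cvg_norm gb.
have b2 : (fun x => `|a| * `|b - g x| : C) @ F --> (`|a| * 0 : C).
  by apply: cvgM g0; exact: cvg_cst.
have bound : (fun x => `|a - f x| * `|g x| + `|a| * `|b - g x| : C) @ F -->
    (0 * `|b| + `|a| * 0 : C) by apply: cvgD b1 b2.
apply/cvgrPdist_lt => e e0.
have {}bound := (cvgrPdist_lt _ _).1 bound _ e0.
near=> x.
have -> : dot H a b - dot H (f x) (g x) =
    dot H (a - f x) (g x) + dot H a (b - g x).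
  rewrite (semidotBl (hilbert_semidot H)) (semidotBr (hilbert_semidot H)) /=.
  by ring.
rewrite (le_lt_trans (ler_normD _ _)) //.
rewrite (le_lt_trans (lerD (dot_le_norm _ _) (dot_le_norm _ _))) //.
suff : `|0 * `|b| + `|a| * 0 - (`|a - f x| * `|g x| + `|a| * `|b - g x|)| < e.
  by rewrite mul0r mulr0 addr0 sub0r normrN ger0_norm.
by near: x; exact: bound.
Unshelve. all: by end_near. Qed.

End DotLimits.

Section Dyadic.
Context (R : realType) (H : hilbertType R).

(** The difference quotients along [2 ^- k] converge at every vector because the
generator is everywhere defined, so that [uniform_boundedness] applies. *)
Lemma bounded_generator_dyadic (S : R -> boundedOp H H) : bounded_generator S ->
  exists2 M : R, 0 <= M &
    forall k x, `|S (2 ^- k) x - x| <= (M * 2 ^- k)%:C%C * `|x|.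
Proof.
move=> [Sdom _].
pose f k : {linear H -> H} :=
  (((2 ^- k)^-1)%:C%C : R[i]) \*: (S (2 ^- k) \- idfun).
have fE k x : f k x = diff_quotient S x (2 ^- k) by [].
have f_bounded k : exists M : R[i], forall x, `|f k x| <= M * `|x|.
  have [M SM] := boundedOpP (S (2 ^- k)).
  exists (`|((2 ^- k)^-1)%:C%C| * (M + 1)) => x.
  rewrite fE normrZ -mulrA ler_wpM2l // mulrDl mul1r.
  by rewrite (le_trans (ler_normB _ _)) // lerD.
have dyadic0 : (2 ^- k : R) @[k --> \oo] --> 0^'+.
  move=> P /= [e /= e0 eP].
  have [N _ Ne] := near_infty_natSinv_expn_lt (PosNum e0).
  exists N => // k Nk; apply: eP => /=; last by rewrite invr_gt0 exprn_gt0.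
  rewrite sub0r normrN ger0_norm ?invr_ge0 ?exprn_ge0 //.
  by have := Ne k Nk; rewrite div1r.
have [M fM] : exists M : R[i], forall k x, `|f k x| <= M * `|x|.
  apply: uniform_boundedness => // x.
  have : generator_dom S x by rewrite Sdom.
  move=> /cvg_ex[l xl].
  have fx : cvgn (f^~ x).
    by apply/cvg_ex; exists l; apply: cvg_comp dyadic0 xl.
  have [M [_ fM]] := cvg_seq_bounded fx.
  by exists (M + 1) => n; apply: fM => //; rewrite ltrDl.
have [r rM] : exists r : R, r%:C%C = `|M|.
  by exists (complex.Re `|M|); rewrite RRe_real ?normr_real.
exists r => [|k x]; first by rewrite -ler0c rM.
have two0 : 0 < 2 ^- k :> R by rewrite invr_gt0 exprn_gt0.
have -> : S (2 ^- k) x - x = (2 ^- k)%:C%C *: f k x.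
  rewrite fE /diff_quotient scalerA -rmorphM mulfV ?gt_eqF //.
  by rewrite rmorph1 scale1r.
rewrite normrZ ger0_norm ?ler0c ?(ltW two0) //.
have -> : (r * 2 ^- k)%:C%C = `|M| * (2 ^- k)%:C%C by rewrite rmorphM /= rM.
rewrite mulrC mulrAC ler_wpM2r ?ler0c ?(ltW two0) //.
have h := fM k x; have Mx : 0 <= M * `|x| := le_trans (normr_ge0 _) h.
by rewrite -(@normr_id _ _ x) -normrM ger0_norm.
Qed.

End Dyadic.

(** * The regular kernel of a semigroup *)

Section RegularKernel.
Context (R : realType) (d : nat) (H : hilbertType R) (T : C0_semigroup d H).
Local Notation C := (R[i] : numClosedFieldType).
Implicit Types (t s : 'rV[R]_d) (x y : H).

Definition regular_kernel t x y : R[i] :=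
  dot H (T (pos_part t) x) (T (neg_part t) y).

Lemma pos_part_orthant t : orthant (pos_part t).
Proof. by move=> i; rewrite mxE le_max lexx orbT. Qed.

Lemma neg_part_orthant t : orthant (neg_part t).
Proof. by move=> i; rewrite mxE le_max lexx orbT. Qed.

Lemma pos_partN t : pos_part (- t) = neg_part t.
Proof. by apply/rowP => i; rewrite !mxE. Qed.

Lemma neg_partN t : neg_part (- t) = pos_part t.
Proof. by rewrite -pos_partN opprK. Qed.

Lemma pos_part_cts : continuous (@pos_part R d).
Proof.
move=> t P /nbhs_ballP[e /= e0 eP]; apply/nbhs_ballP; exists e => //= s [_ ts].
apply: eP; split=> // i j; have := ts i j.
rewrite (ord1 i) -!ball_normE /= !mxE.
rewrite !ltr_norml => /andP[l u].
by case: (leP (t 0 j) 0); case: (leP (s 0 j) 0); lra.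
Qed.

Lemma neg_part_cts : continuous (@neg_part R d).
Proof.
have -> : @neg_part R d = @pos_part R d \o -%R.
  by apply/funext => t /=; rewrite pos_partN.
move=> t; apply: continuous_comp; first exact: opp_continuous.
exact: pos_part_cts.
Qed.

Lemma semigroup_cts_comp (p : 'rV[R]_d -> 'rV[R]_d) x : continuous p ->
  (forall t, orthant (p t)) -> continuous (fun t => T (p t) x).
Proof.
move=> pc p0 t.
have Tx := @sg_cts _ _ _ T x (p t).
have Ft : Filter (p @ nbhs t) by exact: fmap_filter.
have pt : p @ nbhs t --> within orthant (nbhs (p t)).
  move=> P Pp.
  apply: (@filterS _ (nbhs t) _ (fun s => orthant (p s) -> P (p s))).
    by move=> s /(_ (p0 s)).
  exact: pc t _ Pp.
have {}pt := proj2 (subspace_cvgP Ft (p0 t)) pt.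
by move=> P TP; exact: pt _ (Tx _ TP).
Qed.

Lemma regular_kernel_cts x y : continuous (fun t => regular_kernel t x y : C).
Proof.
move=> t.
have px := @semigroup_cts_comp _ x pos_part_cts pos_part_orthant t.
have ny := @semigroup_cts_comp _ y neg_part_cts neg_part_orthant t.
exact: (@cvg_dot _ _ _ (nbhs t) _ _ _ _ _ px ny).
Qed.

Lemma regular_kernel_herm t x y :
  regular_kernel t x y = (regular_kernel (- t) y x)^*.
Proof. by rewrite /regular_kernel pos_partN neg_partN -dotC. Qed.

Lemma regular_kernel_linear t y a x x' :
  regular_kernel t (a *: x + x') y =
  a * regular_kernel t x y + regular_kernel t x' y.
Proof.
rewrite /regular_kernel linearP (semidotDl (hilbert_semidot H)).
by rewrite (semidotZl (hilbert_semidot H)).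
Qed.

Lemma regular_kernel0 x y : regular_kernel 0 x y = dot H x y.
Proof.
have p0 : pos_part 0 = 0 :> 'rV[R]_d.
  by apply/rowP => i; rewrite !mxE maxxx.
by rewrite /regular_kernel -(pos_partN 0) oppr0 p0 !sg0.
Qed.

Definition grid_step (h : R) (i : 'I_d) x := T (h *: delta_mx 0 i) x.

Lemma scale_delta_orthant (h : R) (i : 'I_d) :
  0 <= h -> orthant (h *: delta_mx 0 i : 'rV[R]_d).
Proof. by move=> h0 j; rewrite !mxE mulr_ge0 // ler0n. Qed.

Lemma orthantD t s : orthant t -> orthant s -> orthant (t + s).
Proof. by move=> t0 s0 i; rewrite mxE addr_ge0. Qed.

Lemma grid_stepC h i j x : 0 <= h ->
  grid_step h i (grid_step h j x) = grid_step h j (grid_step h i x).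
Proof.
move=> h0; have hi k := @scale_delta_orthant h k h0.
by rewrite /grid_step -!sgD // addrC.
Qed.

Lemma grid_power h (n : 'I_d -> nat) x : 0 <= h ->
  T (\row_i ((n i)%:R * h)) x = power (grid_step h) (enum 'I_d) n x.
Proof.
move=> h0.
have iterE i k y : iter k (grid_step h i) y = T ((k%:R * h) *: delta_mx 0 i) y.
  elim: k => [|k IH] /=; first by rewrite mul0r scale0r sg0.
  have kh0 : 0 <= k%:R * h by rewrite mulr_ge0.
  rewrite IH /grid_step.
  rewrite -(sgD T (scale_delta_orthant i h0) (scale_delta_orthant i kh0)).
  by rewrite -scalerDl -{1}(mul1r h) -mulrDl nat1r.
have sumO (L : seq 'I_d) :
    orthant (\sum_(i <- L) ((n i)%:R * h) *: delta_mx 0 i : 'rV[R]_d).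
  elim: L => [|i L IH]; first by rewrite big_nil => j; rewrite mxE.
  rewrite big_cons; apply: orthantD => //; apply: scale_delta_orthant.
  by rewrite mulr_ge0.
have -> : \row_i ((n i)%:R * h) =
    \sum_(i <- enum 'I_d) ((n i)%:R * h) *: delta_mx 0 i :> 'rV[R]_d.
  by rewrite [LHS]row_sum_delta big_enum; apply: eq_bigr => i _; rewrite mxE.
elim: (enum 'I_d) => [|i L IH] /=; first by rewrite big_nil sg0.
have nh0 : 0 <= (n i)%:R * h by rewrite mulr_ge0.
rewrite big_cons (sgD T (scale_delta_orthant i nh0) (sumO L)).
by rewrite iterE IH.
Qed.

(** On the grid, positive and negative parts of differences are truncated
differences of exponents. *)
Lemma regular_kernel_grid h (m n : 'I_d -> nat) x y : 0 <= h ->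
  regular_kernel (\row_i ((m i)%:R * h) - \row_i ((n i)%:R * h)) x y =
  dot H (power (grid_step h) (enum 'I_d) (fun i => m i - n i)%N x)
        (power (grid_step h) (enum 'I_d) (fun i => n i - m i)%N y).
Proof.
move=> h0.
have posE (a b : 'I_d -> nat) :
    pos_part (\row_i ((a i)%:R * h) - \row_i ((b i)%:R * h)) =
    \row_i ((a i - b i)%N%:R * h).
  apply/rowP => i; rewrite !mxE -mulrBl.
  have [ab|ba] := leqP (a i) (b i).
    rewrite (eqP ab) mul0r; apply/max_idPr.
    by rewrite mulr_le0_ge0 // subr_le0 ler_nat.
  rewrite natrB 1?ltnW //; apply/max_idPl.
  by rewrite mulr_ge0 // subr_ge0 ler_nat ltnW.
by rewrite /regular_kernel -pos_partN opprB !posE !grid_power.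
Qed.

End RegularKernel.

Section RegularKernelPositive.
Context (R : realType) (d : nat) (H : hilbertType R) (T : C0_semigroup d H).
Local Notation C := (R[i] : numClosedFieldType).
Hypothesis T_brehmer :
  forall k, brehmer (grid_step T (2 ^- k)) (enum 'I_d) (dot H).

Lemma dyadic_ge0 k : 0 <= 2 ^- k :> R.
Proof. by rewrite invr_ge0 exprn_ge0. Qed.

Lemma regular_kernel_dyadic_ge0 k (A : seq 'rV[R]_d)
    (n : 'rV[R]_d -> 'I_d -> nat) (x : 'rV[R]_d -> H) :
  0 <= \sum_(t <- A) \sum_(s <- A) regular_kernel T
    (\row_i ((n t i)%:R * 2 ^- k) - \row_i ((n s i)%:R * 2 ^- k)) (x t) (x s).
Proof.
under eq_bigr do under eq_bigr do rewrite regular_kernel_grid ?dyadic_ge0 //.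
apply: brehmer_kernel_ge0 => //.
- by move=> i; rewrite /grid_step linear0.
- by move=> i j y; apply: grid_stepC; exact: dyadic_ge0.
- by move=> i y z; rewrite /grid_step linearD.
split=> [z|z] y y'.
  exact: (semidotDl (hilbert_semidot H)).
exact: (semidotDr (hilbert_semidot H)).
Qed.

Definition dyadic_floor k (t : 'rV[R]_d) (i : 'I_d) : nat :=
  Num.truncn (t 0 i * 2 ^+ k).

Lemma dyadic_floor_cvg t : orthant t ->
  (fun k => \row_i ((dyadic_floor k t i)%:R * 2 ^- k) : 'rV[R]_d) @ \oo --> t.
Proof.
move=> t0 P /nbhs_ballP[e /= e0 eP].
have [N _ Ne] := near_infty_natSinv_expn_lt (PosNum e0).
exists N => // k Nk; apply: eP; split=> // i j.
rewrite (ord1 i) -ball_normE /= mxE.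
apply: le_lt_trans (Ne k Nk); rewrite div1r.
have k0 : 0 < 2 ^+ k :> R by rewrite exprn_gt0.
have tk : 0 <= t 0 j * 2 ^+ k by rewrite mulr_ge0 ?(ltW k0) //; exact: t0.
have /andP[l u] := truncn_itv tk.
rewrite -{1}[t 0 j](mulfK (lt0r_neq0 k0)) -mulrBl normrM.
rewrite [X in _ * X]ger0_norm ?dyadic_ge0 // ger0_norm ?subr_ge0 //.
rewrite -[X in _ <= X]mul1r ler_wpM2r ?dyadic_ge0 //.
by rewrite lerBlDl natr1 ltW.
Qed.

Lemma cvg_sum_seq (J : eqType) (A : seq J) (f : nat -> J -> C) (l : J -> C) :
  (forall j, j \in A -> (f k j @[k --> \oo] --> l j)) ->
  (fun k => \sum_(j <- A) f k j) @ \oo --> (\sum_(j <- A) l j : C).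
Proof.
elim: A => [|j A IH] fl.
  rewrite big_nil; under eq_fun do rewrite big_nil; exact: cvg_cst.
rewrite big_cons; under eq_fun do rewrite big_cons.
apply: cvgD; first by apply: fl; rewrite mem_head.
by apply: IH => i iA; apply: fl; rewrite in_cons iA orbT.
Qed.

(** Only differences of times matter, so the times can be translated into the
orthant and approximated there by dyadic grids, where Brehmer's criterion
applies. *)
Lemma regular_kernel_ge0 (A : seq 'rV[R]_d) (x : 'rV[R]_d -> H) :
  0 <= \sum_(t <- A) \sum_(s <- A) regular_kernel T (t - s) (x t) (x s).
Proof.
(* Adding [c] moves all the times of [A] into the orthant. *)
pose c : 'rV[R]_d := \row_i \sum_(t <- A) `|t 0 i|.
have tc t : t \in A -> orthant (t + c).
  move=> tA i; rewrite !mxE (big_rem t tA) /= addrA addr_ge0 ?sumr_ge0 //.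
  by have := ler_norm (- t 0 i); rewrite normrN -subr_ge0 opprK addrC.
pose grid k t : 'rV[R]_d := \row_i ((dyadic_floor k (t + c) i)%:R * 2 ^- k).
pose f k := \sum_(t <- A) \sum_(s <- A)
    regular_kernel T (grid k t - grid k s) (x t) (x s).
have f0 k : 0 <= f k by exact: regular_kernel_dyadic_ge0.
apply: (@cvg_ge0 _ _ \oo _ f); last by near=> k.
apply: cvg_sum_seq => t tA; apply: cvg_sum_seq => s sA.
have ts : (fun k => grid k t - grid k s) @ \oo --> t - s.
  have -> : t - s = (t + c) - (s + c) by rewrite opprD addrACA subrr addr0.
  by apply: cvgB; apply: dyadic_floor_cvg; exact: tc.
have kc := @regular_kernel_cts _ _ _ T (x t) (x s) (t - s).
by move=> P kP; exact: ts _ (kc _ kP).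
Unshelve. all: by end_near. Qed.

(** The two adjoints of the definition are determined by the same sesquilinear
form, so that they agree whether or not they are known to exist. *)
Theorem brehmer_regular_dilation : has_regular_unitary_dilation T.
Proof.
have [H' [U [r Ur]]] := naimark (regular_kernel_linear T)
  (regular_kernel_herm T) regular_kernel_ge0 (@regular_kernel_cts _ _ _ T)
  (regular_kernel0 T).
exists H', U, r => t x; rewrite /adjoint; congr (xget 0 _).
apply/seteqP; split=> z /= zP y.
  by rewrite -zP dotC Ur -dotC.
by rewrite -zP (dotC (r y)) Ur -dotC.
Qed.

End RegularKernelPositive.

(** * The damped semigroup *)

(** The damping wins because [1 - q ^+ 2] is at least [q ^+ 2 * (2 * (h * w))],
whereas an undamped step of mesh [h] is within [M * h] of the identity; the mesh
cancels. *)
Lemma damping_estimate (R : realType) (h w M : R) :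
  let q := expR (- (h * w)) in
  0 <= h -> h <= 1 -> 0 < w -> 0 <= M ->
  q ^+ 2 * (2 * (M * h) * (2 + M * h)) <= (1 - q ^+ 2) * (M * (2 + M) / w).
Proof.
move=> q h0 h1 w0 M0; have q0 : 0 < q := expR_gt0 _.
have q2 : 1 = q ^+ 2 * expR (2 * (h * w)).
  by rewrite -expRM_natl -expRD -[LHS]expR0; congr expR; ring.
have le1 : q ^+ 2 * (2 * (h * w)) <= 1 - q ^+ 2.
  have -> : 1 - q ^+ 2 = q ^+ 2 * (expR (2 * (h * w)) - 1).
    by rewrite mulrBr -q2 mulr1.
  rewrite ler_pM2l ?exprn_gt0 //.
  by rewrite lerBrDl expR_ge1Dx.
have K0 : 0 <= M * (2 + M) / w.
  by rewrite divr_ge0 ?mulr_ge0 ?addr_ge0 ?(ltW w0).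
apply: le_trans (ler_wpM2r K0 le1).
rewrite (_ : q ^+ 2 * _ * _ = q ^+ 2 * (2 * (M * h) * (2 + M))); last first.
  by field; rewrite gt_eqF.
rewrite ler_pM2l ?exprn_gt0 // ler_wpM2l ?mulr_ge0 // lerD2l.
by rewrite ler_piMr.
Qed.

Theorem corollary1p2 (R : realType) (d : nat) (hd : (0 < d)%N)
    (H : hilbertType R) (T : C0_semigroup d H)
    (hT : forall i : 'I_d, bounded_generator (marginal T i)) :
  exists2 w : 'rV[R]_d, orthant w & has_regular_unitary_dilation (damped T w).
Proof.
have [M0 M0_ge0 M0P] : exists2 M : 'I_d -> R, (forall i, 0 <= M i) &
    forall i k x,
      `|T (2 ^- k *: delta_mx 0 i) x - x| <= (M i * 2 ^- k)%:C%C * `|x|.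
  have /choice[M MP] i : exists M, 0 <= M /\
    forall k x, `|T (2 ^- k *: delta_mx 0 i) x - x| <= (M * 2 ^- k)%:C%C * `|x|.
    by have [M M_ge0 TM] := bounded_generator_dyadic (hT i); exists M.
  by exists M => i; have [] := MP i.
pose M := \sum_i M0 i.
have M_ge0 : 0 <= M by exact: sumr_ge0.
have M_ge i : M0 i <= M by rewrite /M (bigD1 i) //= lerDl sumr_ge0.
pose K := M * (2 + M).
have K_ge0 : 0 <= K by rewrite mulr_ge0 // addr_ge0.
(* The [d] defects cost at most [d * (K / w) <= 1]. *)
pose w := d%:R * K + 1.
have w_gt0 : 0 < w by rewrite ltr_wpDl // mulr_ge0.
exists (const_mx w) => [i|]; first by rewrite mxE ltW.
apply: brehmer_regular_dilation => k; set h := 2 ^- k.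
have h_gt0 : 0 < h by rewrite invr_gt0 exprn_gt0.
have h_le1 : h <= 1 by rewrite invf_le1 ?exprn_gt0 // exprn_ege1 // ler1n.
have -> : grid_step (damped T (const_mx w)) h =
    fun i x => (expR (- (h * w)))%:C%C *: T (h *: delta_mx 0 i) x.
  apply/funext => i; apply/funext => x; rewrite /grid_step /= /damping /pairing.
  rewrite (bigD1 i) //= !mxE !eqxx mulr1 big1 ?addr0 // => j ji.
  by rewrite !mxE (negPf ji) andbF mulr0 mul0r.
apply: (@brehmer_dot _ _ _ (fun i => T (h *: delta_mx 0 i) : {linear H -> H})
  _ (M * h)%:C%C (K / w)%:C%C).
- by rewrite ltcR expR_gt0.
- by rewrite ltcR expR_lt1 oppr_lt0 mulr_gt0.
- move=> i x; rewrite (le_trans (M0P i k x)) // ler_wpM2r // lecR.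
  by rewrite ler_wpM2r ?(ltW h_gt0).
- by rewrite ler0c divr_ge0 ?(ltW w_gt0).
- have := damping_estimate (ltW h_gt0) h_le1 w_gt0 M_ge0.
  rewrite -lecR !(rmorphM, rmorphB, rmorphD, rmorphXn, rmorph1, rmorph_nat) //=.
rewrite size_enum_ord -(rmorph_nat (real_complex R)) -rmorphM lecR.
by rewrite mulrA ler_pdivrMr // mul1r lerDl.
Qed.
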